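(* Let $(\pi_{1},\pi_{2})$ be a pair of $2$-sections on a Lie algebroid $A$ over a manifold $M$ (i.e. $\pi_1,\pi_2\in\Gamma(\Lambda^2A)$). Then $(\pi_{1},\pi_{2})$ is a Poisson pair on $A$ if and only if $((\pi_{1},0),(\pi_{2},0))$ is a Jacobi pair on the Jacobi algebroid $(A\oplus\mathbb{R},(0,1))$ over $M$.
   Context: Lie algebroids. A Lie algebroid over $M$ is a vector bundle $A\to M$ with a Lie bracket $[\cdot,\cdot]_A$ on $\Gamma(A)$ and a bundle map $\rho_A:A\to TM$ with $[X,fY]_A=f[X,Y]_A+(\rho_A(X)f)Y$. The Schouten bracket on $\Gamma(\Lambda^*A)$ is the unique extension of the Lie bracket with $[f,g]_A=0$, $[X,f]_A=\rho_A(X)f$, $[D_1,D_2\wedge D_3]_A=[D_1,D_2]_A\wedge D_3+(-1)^{(a_1+1)a_2}D_2\wedge[D_1,D_3]_A$, $[D_1,D_2]_A=-(-1)^{(a_1-1)(a_2-1)}[D_2,D_1]_A$ for $D_i\in\Gamma(\Lambda^{a_i}A)$. The differential $d_A$ on $\Gamma(\Lambda^*A^* )$ is the usual Lie algebroid differential: $(d_A\omega)(X_0,\dots,X_k)=\sum_i(-1)^i\rho_A(X_i)(\omega(X_0,\dots,\hat X_i,\dots,X_k))+\sum_{i<j}(-1)^{i+j}\omega([X_i,X_j]_A,X_0,\dots,\hat X_i,\dots,\hat X_j,\dots,X_k)$. Jacobi algebroids. A Jacobi algebroid $(A,\phi_0)$ is a Lie algebroid $A$ with $\phi_0\in\Gamma(A^*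 )$, $d_A\phi_0=0$. For $D_i\in\Gamma(\Lambda^{a_i}A)$, $[D_1,D_2]_{A,\phi_0}:=[D_1,D_2]_A+(a_1-1)D_1\wedge\iota_{\phi_0}D_2-(-1)^{a_1+1}(a_2-1)\iota_{\phi_0}D_1\wedge D_2$. On $\Gamma(\Lambda^*A^* )$, $d_{A,\phi_0}\omega:=d_A\omega+\phi_0\wedge\omega$ and $\mathcal{L}^{A,\phi_0}_X:=\iota_Xd_{A,\phi_0}+d_{A,\phi_0}\iota_X$. A Jacobi structure on $(A,\phi_0)$ is $\pi\in\Gamma(\Lambda^2A)$ with $[\pi,\pi]_{A,\phi_0}=0$. A Poisson structure on a Lie algebroid $A$ is $\pi\in\Gamma(\Lambda^2A)$ with $[\pi,\pi]_A=0$ (the case $\phi_0=0$). The Jacobi algebroid $(A\oplus\mathbb{R},(0,1))$. $A\oplus\mathbb{R}:=A\oplus(M\times\mathbb{R})$, with sections $(X,f)\in\Gamma(A)\oplus C^\infty(M)$, bracket $[(X,f),(Y,g)]_{A\oplus\mathbb{R}}:=([X,Y]_A,\rho_A(X)g-\rho_A(Y)f)$ and anchor $(X,f)\mapsto\rho_A(X)$. Sections of the dual are $(\alpha,f)\in\Gamma(A^* )\oplus C^\infty(M)$ with pairing $\langle(\alpha,f),(X,g)\rangle=\langle\alpha,X\rangle+fg$, and $(0,1)$ is the element $\phi_0=(0,1)\in\Gamma(A^* )\oplus C^\infty(M)$. $\Gamma(\Lambda^2(A\oplus\mathbb{R}))$ is identified with $\Gamma(\Lambda^2A)\oplus\Gamma(A)$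 via $(P,Q)((\alpha_1,f_1),(\alpha_2,f_2))=P(\alpha_1,\alpha_2)+f_1Q(\alpha_2)-f_2Q(\alpha_1)$; thus $(\pi,0)$ is the 2-section $((\alpha_1,f_1),(\alpha_2,f_2))\mapsto\pi(\alpha_1,\alpha_2)$. Dirac structures on a Jacobi algebroid $(A,\phi_0)$. On $A\oplus A^*$ let $(X+\xi,Y+\eta)_\pm:=\frac12(\langle\xi,Y\rangle\pm\langle\eta,X\rangle)$ and $[\![X+\xi,Y+\eta]\!]:=[X,Y]_A+\big(\mathcal{L}^{A,\phi_0}_X\eta-\mathcal{L}^{A,\phi_0}_Y\xi+d_{A,\phi_0}(X+\xi,Y+\eta)_-\big)$. A Dirac structure on $(A,\phi_0)$ is a subbundle $L\subset A\oplus A^*$ maximally isotropic for $(\cdot,\cdot)_+$ with $\Gamma(L)$ closed under $[\![\cdot,\cdot]\!]$. A Dirac structure on a Lie algebroid $A$ is one on $(A,0)$. For $\pi\in\Gamma(\Lambda^2A)$, $\langle\pi^\sharp\xi,\eta\rangle:=\pi(\xi,\eta)$, and $\overline{\mathrm{graph}\,\pi^\sharp}:=\{(\pi^\sharp\xi,\xi)\mid\xi\in A^*\}\subset A\times A^*$ (fibrewise; identified with a subbundle of $A\oplus A^*$). Relations. Relations between vector bundles over the same base are understood fibrewise. For $R\subset A\times A$, $R^*:=\{(\beta,\alpha)\in A^*\times A^*\mid\langle\alpha,u\rangle=\langle\beta,v\rangle\ \forall(u,v)\in R\}$ fibrewise; $\underline{R}$ is the set of pairs of sections with values in $R$ at every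 point. The Nijenhuis torsion is $\mathcal{T}_R((X_1,Y_1),(X_2,Y_2),(\alpha,\beta,\gamma)):=\langle\alpha,[Y_1,Y_2]_A\rangle-\langle\beta,[Y_1,X_2]_A+[X_1,Y_2]_A\rangle+\langle\gamma,[X_1,X_2]_A\rangle$ for $(X_i,Y_i)\in\underline{R}$ and $(\alpha,\beta),(\beta,\gamma)\in\underline{R^*}$; $R$ is Nijenhuis if $\mathcal{T}_R\equiv0$. Dirac, Poisson and Jacobi pairs. For $L,L'\subset A\times A^*$, $\mathrm{N}_{L,L'}:=\{(x,y)\in A\times A\mid\exists\alpha\in A^*:(x,\alpha)\in L',\ (y,\alpha)\in L\}$ (fibrewise). A pair $(L,L')$ of Dirac structures on $(A,\phi_0)$ is a Dirac pair on $(A,\phi_0)$ if $\mathrm{N}_{L,L'}$ is a Nijenhuis relation; a Dirac pair on a Lie algebroid $A$ is one on $(A,0)$. A pair of Jacobi structures $(\pi_1,\pi_2)$ on $(A,\phi_0)$ is a Jacobi pair if $(\overline{\mathrm{graph}\,\pi_1^\sharp},\overline{\mathrm{graph}\,\pi_2^\sharp})$ is a Dirac pair on $(A,\phi_0)$. A pair of Poisson structures $(\pi_1,\pi_2)$ on a Lie algebroid $A$ is a Poisson pair if $(\overline{\mathrm{graph}\,\pi_1^\sharp},\overline{\mathrm{graph}\,\pi_2^\sharp})$ is a Dirac pair on $A$. *)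

(* Defs.v *)
From HB Require Import structures.
From mathcomp Require Import all_boot all_order all_algebra.
From mathcomp Require Import all_classical all_reals all_analysis.
From mathcomp Require Import ring.
Import Order.TTheory GRing.Theory Num.Theory numFieldNormedType.Exports.

Set Implicit Arguments.
Unset Strict Implicit.
Unset Printing Implicit Defensive.

Local Open Scope classical_set_scope.
Local Open Scope ring_scope.

Section Euclidean.
Context {R : realType} {n : nat}.
Implicit Types (U V : set 'rV[R]_n) (f g : 'rV[R]_n -> R).

(* All partial derivatives of order at most [k] exist and are continuous at
   every point of [U]; only meant for an open [U]. *)
Fixpoint Ck (k : nat) U f : Prop :=
  (forall x, U x -> {for x, continuous f}) /\
  (if k is k'.+1 then
     forall i : 'I_n,
       (forall x, U x -> derivable f x (delta_mx 0 i)) /\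
       Ck k' U ('D_(delta_mx 0 i) f)
   else True).

Definition smooth_on U f : Prop := forall k, Ck k U f.

Lemma Ck_cont k U f : Ck k U f -> forall x, U x -> {for x, continuous f}.
Proof. by case: k => [|k] []. Qed.

Lemma Ck_sub k U V f : V `<=` U -> Ck k U f -> Ck k V f.
Proof.
move=> VU; elim: k f => [|k IH] f [fc fd]; split => //.
- by move=> x /VU; exact: fc.
- by move=> x /VU; exact: fc.
- move=> i; have [h1 h2] := fd i; split; last exact: IH.
  by move=> x /VU; exact: h1.
Qed.

Lemma Ck_eq k U f g : open U -> (forall x, U x -> f x = g x) ->
  Ck k U f -> Ck k U g.
Proof.
move=> oU.
have near_fg (h h' : 'rV[R]_n -> R) x : (forall x, U x -> h x = h' x) -> U x ->
    {near x, h =1 h'}.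
  by move=> hh' Ux; near=> y; apply: hh'; near: y; exact: open_nbhs_nbhs.
have cont (h h' : 'rV[R]_n -> R) : (forall x, U x -> h x = h' x) ->
    (forall x, U x -> {for x, continuous h}) ->
    forall x, U x -> {for x, continuous h'}.
  move=> hh' hc x Ux; rewrite /prop_for /continuous_at -(hh' _ Ux).
  exact: cvg_trans (near_eq_cvg (near_fg h h' x hh' Ux)) (hc _ Ux).
elim: k f g => [|k IH] f g fg [fc fd]; split => //;
  try exact: cont fc.
move=> i; have [h1 h2] := fd i; split.
  by move=> x Ux; apply: near_eq_derivable (h1 _ Ux); exact: near_fg.
apply: IH h2 => x Ux; apply: near_eq_derive; exact: near_fg.
Unshelve. all: by end_near. Qed.

Lemma Ck_cst k U (c : R) : open U -> Ck k U (fun=> c).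
Proof.
move=> oU; elim: k c => [|k IH] c; split => //.
1,2: by move=> x _; exact: cst_continuous.
move=> i; split; first by move=> x _; exact: derivable_cst.
by apply: Ck_eq (IH 0) => // x _; rewrite (derive_cst c).
Qed.

Lemma Ck_add k U f g : open U ->
  Ck k U f -> Ck k U g -> Ck k U (fun x => f x + g x).
Proof.
move=> oU; elim: k f g => [|k IH] f g [fc fd] [gc gd]; split => //.
- by move=> x Ux; apply: continuousD; [exact: fc|exact: gc].
- by move=> x Ux; apply: continuousD; [exact: fc|exact: gc].
move=> i; have [h1 h2] := fd i; have [h3 h4] := gd i; split.
  by move=> x Ux; apply: derivableD; [exact: h1|exact: h3].
apply: Ck_eq (IH _ _ h2 h4) => // x Ux.
by rewrite -deriveD; [|exact: h1|exact: h3].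
Qed.

Lemma Ck_local k U f : (forall x, U x -> exists V, V x /\ Ck k V f) -> Ck k U f.
Proof.
elim: k f => [|k IH] f H; split => //.
- by move=> x /H[V [Vx [+ _]]]; apply.
- by move=> x /H[V [Vx [+ _]]]; apply.
move=> i; split.
  by move=> x /H[V [Vx [_ /(_ i)[+ _]]]]; apply.
apply: IH => x /H[V [Vx [_ /(_ i)[_ ?]]]].
by exists V.
Qed.

Lemma CkW k U f : Ck k.+1 U f -> Ck k U f.
Proof.
elim: k f => [|k IH] f [fc fd]; split => // i.
by have [h1 h2] := fd i; split => //; exact: IH.
Qed.

Lemma Ck_mul k U f g : open U ->
  Ck k U f -> Ck k U g -> Ck k U (fun x => f x * g x).
Proof.
move=> oU; elim: k f g => [|k IH] f g Hf Hg.
  split => // x Ux; apply: continuousM; [exact: (Ck_cont Hf)|exact: (Ck_cont Hg)].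
have Hf' := CkW Hf; have Hg' := CkW Hg.
move: Hf Hg => [fc fd] [gc gd]; split.
  by move=> x Ux; apply: continuousM; [exact: fc|exact: gc].
move=> i; have [h1 h2] := fd i; have [h3 h4] := gd i; split.
  by move=> x Ux; apply: derivableM; [exact: h1|exact: h3].
apply: Ck_eq (Ck_add oU (IH _ _ Hf' h4) (IH _ _ Hg' h2)) => // x Ux.
by rewrite deriveM; [|exact: h1|exact: h3].
Qed.

End Euclidean.

Section Manifold.
Context {R : realType}.

Record chart (M : topologicalType) (n : nat) := Chart {
  cdom : set M;
  cimg : set 'rV[R]_n;
  cmap : M -> 'rV[R]_n;
  cinv : 'rV[R]_n -> M;
  cdom_open : open cdom;
  cimg_open : open cimg;
  cmap_img : forall p, cdom p -> cimg (cmap p);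
  cinv_dom : forall x, cimg x -> cdom (cinv x);
  cmapK : forall p, cdom p -> cinv (cmap p) = p;
  cinvK : forall x, cimg x -> cmap (cinv x) = x;
  cmap_cont : forall p, cdom p -> {for p, continuous cmap};
  cinv_cont : forall x, cimg x -> {for x, continuous cinv} }.

Record manifold := Manifold {
  mcarrier :> topologicalType;
  mdim : nat;
  matlas : set (chart mcarrier mdim);
  m_hausdorff : hausdorff_space mcarrier;
  m_second_countable : second_countable (T := mcarrier);
  matlas_cover : forall p, exists2 c, matlas c & cdom c p;
  matlas_compat : forall c c', matlas c -> matlas c' ->
    forall i : 'I_mdim,
      smooth_on (cimg c `&` cinv c @^-1` cdom c')
                (fun x => cmap c' (cinv c x) 0 i) }.

Context {M : manifold}.
Implicit Types (W : set M) (f g : M -> R).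

Definition smooth_fun_on W f : Prop :=
  forall c, matlas c ->
    smooth_on (cimg c `&` cinv c @^-1` W) (f \o cinv c).

Definition smooth_fun f : Prop := smooth_fun_on setT f.

Lemma open_chart_preimage (c : chart M (mdim M)) W : open W ->
  open (cimg c `&` cinv c @^-1` W).
Proof.
move=> oW; rewrite openE => x [cx Wx]; apply: filterI.
  by apply: open_nbhs_nbhs; split => //; exact: cimg_open.
by apply: (cinv_cont cx); apply: open_nbhs_nbhs.
Qed.

Lemma smooth_fun_on_sub W W' f : W' `<=` W ->
  smooth_fun_on W f -> smooth_fun_on W' f.
Proof.
move=> WW' sf c ac k; apply: Ck_sub (sf c ac k) => x [? ?].
by split=> //; exact: WW'.
Qed.

Lemma smooth_fun_on_eq W f g : open W -> (forall p, W p -> f p = g p) ->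
  smooth_fun_on W f -> smooth_fun_on W g.
Proof.
move=> oW fg sf c ac k; apply: Ck_eq (sf c ac k).
  exact: open_chart_preimage.
by move=> x [_ Wx] /=; exact: fg.
Qed.

Lemma smooth_fun_on_cst W (a : R) : open W -> smooth_fun_on W (fun=> a).
Proof. by move=> oW c ac k; apply: Ck_cst; exact: open_chart_preimage. Qed.

Lemma smooth_fun_onD W f g : open W -> smooth_fun_on W f ->
  smooth_fun_on W g -> smooth_fun_on W (fun p => f p + g p).
Proof.
move=> oW sf sg c ac k; apply: (Ck_add _ (sf c ac k) (sg c ac k)).
exact: open_chart_preimage.
Qed.

Lemma smooth_fun_onM W f g : open W -> smooth_fun_on W f ->
  smooth_fun_on W g -> smooth_fun_on W (fun p => f p * g p).
Proof.
move=> oW sf sg c ac k; apply: (Ck_mul _ (sf c ac k) (sg c ac k)).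
exact: open_chart_preimage.
Qed.

Lemma smooth_fun_on_local W f :
  (forall p, W p -> exists W', W' p /\ smooth_fun_on W' f) ->
  smooth_fun_on W f.
Proof.
move=> H c ac k; apply: Ck_local => x [cx /H[W' [W'x sf]]].
exists (cimg c `&` cinv c @^-1` W'); split; first by split.
exact: sf.
Qed.

Lemma smooth_fun_onB W f g : open W -> smooth_fun_on W f ->
  smooth_fun_on W g -> smooth_fun_on W (fun p => f p - g p).
Proof.
move=> oW sf sg.
have sN := smooth_fun_onM oW (smooth_fun_on_cst (-1) oW) sg.
by apply: smooth_fun_on_eq (smooth_fun_onD oW sf sN) => // p _; rewrite mulN1r.
Qed.

(* Only the values of [D] on smooth functions matter. *)
Definition tangent_vector (p : M) (D : (M -> R) -> R) : Prop :=
  (forall (a : R) f g, smooth_fun f -> smooth_fun g ->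
     D (fun q => a * f q + g q) = a * D f + D g) /\
  (forall f g, smooth_fun f -> smooth_fun g ->
     D (fun q => f q * g q) = D f * g p + f p * D g).

End Manifold.

Arguments manifold : clear implicits.

Lemma linfun_linE (R : realType) (U V : vectType R) (f : U -> V) :
  linear f -> forall u, linfun f u = f u.
Proof.
move=> lf u.
pose F : {linear U -> V} := HB.pack f (GRing.isLinear.Build R U V _ f lf).
exact: (lfunE F u).
Qed.

Section VectorBundle.
Context {R : realType} {M : manifold R}.

(* Local trivialisation of a family of vector spaces; the rank may depend on
   the trivialisation, so it is only locally constant. *)
Record triv (E : M -> vectType R) := Triv {
  tdom : set M;
  trank : nat;
  tmap : forall p, 'Hom(E p, 'rV[R]_trank);
  tinv : forall p, 'Hom('rV[R]_trank, E p);
  tdom_open : open tdom;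
  tmapK : forall p, tdom p -> cancel (tmap p) (tinv p);
  tinvK : forall p, tdom p -> cancel (tinv p) (tmap p) }.

Definition tframe (E : M -> vectType R) (t : triv E) (i : 'I_(trank t)) p :
  E p := tinv t p (delta_mx 0 i).

Record vbundle := VBundle {
  fiber :> M -> vectType R;
  batlas : set (triv fiber);
  batlas_cover : forall p, exists2 t, batlas t & tdom t p;
  batlas_compat : forall t t', batlas t -> batlas t' ->
    forall (i : 'I_(trank t)) (j : 'I_(trank t')),
      smooth_fun_on (tdom t `&` tdom t')
                    (fun p => tmap t' p (tframe i p) 0 j) }.

Definition section (E : vbundle) := forall p, E p.

Definition zero_section (E : vbundle) : section E := fun=> 0.

Definition smooth_section_on (E : vbundle) (W : set M) (X : section E) :=
  forall t, batlas t -> forall j : 'I_(trank t),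
    smooth_fun_on (tdom t `&` W) (fun p => tmap t p (X p) 0 j).

Definition smooth_section (E : vbundle) (X : section E) :=
  smooth_section_on setT X.

Section Dual.
Variable E : vbundle.

Definition dual_fiber (p : M) : vectType R := 'Hom(E p, R^o).

Definition dual_tmap (t : triv E) p : 'Hom(dual_fiber p, 'rV[R]_(trank t)) :=
  linfun (fun a : dual_fiber p => \row_j (a (tframe j p) : R)).

Definition dual_tinv (t : triv E) p : 'Hom('rV[R]_(trank t), dual_fiber p) :=
  linfun (fun w : 'rV[R]_(trank t) =>
    linfun (fun v : E p => \sum_j w 0 j * tmap t p v 0 j : R^o)
      : dual_fiber p).

Lemma dual_tmapE t p a j : dual_tmap t p a 0 j = a (tframe j p).
Proof.
rewrite /dual_tmap linfun_linE ?mxE// => c u v.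
by apply/rowP => i; rewrite !mxE lfunE /= lfunE.
Qed.

Lemma dual_tinvE t p w v : dual_tinv t p w v = \sum_j w 0 j * tmap t p v 0 j.
Proof.
have lin (w' : 'rV[R]_(trank t)) :
    linear (fun v : E p => \sum_j w' 0 j * tmap t p v 0 j : R^o).
  move=> c x y; rewrite scaler_sumr -big_split /=; apply: eq_bigr => j _.
  by rewrite linearP !mxE mulrDr mulrCA.
rewrite /dual_tinv linfun_linE ?linfun_linE// => c x y.
apply/lfunP => u; rewrite lfunE /= lfunE /= !linfun_linE//.
rewrite scaler_sumr -big_split /=; apply: eq_bigr => j _.
by rewrite !mxE mulrDl -mulrA.
Qed.

Lemma tmap_expand (t : triv E) p v : tdom t p ->
  v = \sum_j tmap t p v 0 j *: tframe j p.
Proof.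
move=> tp; rewrite -[LHS](tmapK tp) [in LHS](row_sum_delta (tmap t p v)).
by rewrite linear_sum; apply: eq_bigr => j _; rewrite linearZ.
Qed.

Program Definition dual_triv (t : triv E) : triv dual_fiber :=
  @Triv dual_fiber (tdom t) (trank t) (dual_tmap t) (dual_tinv t) _ _ _.
Next Obligation. by move=> t; exact: tdom_open. Qed.
Next Obligation.
move=> t p tp a; apply/lfunP => v; rewrite dual_tinvE.
rewrite [in RHS](tmap_expand v tp) linear_sum; apply: eq_bigr => j _.
by rewrite linearZ dual_tmapE mulrC.
Qed.
Next Obligation.
move=> t p tp w; apply/rowP => i; rewrite dual_tmapE dual_tinvE.
rewrite /tframe tinvK// (bigD1 i)//= mxE !eqxx mulr1 big1 ?addr0// => j ji.
by rewrite mxE eqxx (negPf ji) mulr0.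
Qed.

Program Definition dual : vbundle :=
  @VBundle dual_fiber [set dual_triv t | t in @batlas E] _ _.
Next Obligation.
move=> p; have [t bt tp] := batlas_cover E p.
by exists (dual_triv t) => //; exists t.
Qed.
Next Obligation.
move=> _ _ [t bt <-] [t' bt' <-] /= i j.
rewrite setIC; apply: smooth_fun_on_eq (batlas_compat bt' bt j i).
  by apply: openI; exact: tdom_open.
move=> p _; rewrite dual_tmapE /tframe /= dual_tinvE (bigD1 i)//= mxE !eqxx.
by rewrite mul1r big1 ?addr0// => k ki; rewrite mxE eqxx (negPf ki) mul0r.
Qed.

End Dual.

Section Whitney.
Variables E F : vbundle.

Definition whitney_fiber (p : M) : vectType R := (E p * F p)%type.

Definition whitney_tmap (t : triv E) (u : triv F) p :
    'Hom(whitney_fiber p, 'rV[R]_(trank t + trank u)) :=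
  linfun (fun x : whitney_fiber p => row_mx (tmap t p x.1) (tmap u p x.2)).

Definition whitney_tinv (t : triv E) (u : triv F) p :
    'Hom('rV[R]_(trank t + trank u), whitney_fiber p) :=
  linfun (fun w : 'rV[R]_(trank t + trank u) =>
    (tinv t p (lsubmx w), tinv u p (rsubmx w)) : whitney_fiber p).

Lemma whitney_tmapE t u p x :
  whitney_tmap t u p x = row_mx (tmap t p x.1) (tmap u p x.2).
Proof.
by rewrite linfun_linE// => c y z /=; rewrite !linearP scale_row_mx add_row_mx.
Qed.

Lemma whitney_tinvE t u p w :
  whitney_tinv t u p w = (tinv t p (lsubmx w), tinv u p (rsubmx w)).
Proof. by rewrite linfun_linE// => c y z /=; rewrite !linearP. Qed.

Program Definition whitney_triv (t : triv E) (u : triv F) :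
    triv whitney_fiber :=
  @Triv whitney_fiber (tdom t `&` tdom u) (trank t + trank u)
    (whitney_tmap t u) (whitney_tinv t u) _ _ _.
Next Obligation. by move=> t u; apply: openI; exact: tdom_open. Qed.
Next Obligation.
move=> t u p [tp up] [x y].
by rewrite whitney_tmapE whitney_tinvE row_mxKl row_mxKr !tmapK.
Qed.
Next Obligation.
move=> t u p [tp up] w.
by rewrite whitney_tinvE whitney_tmapE /= !tinvK// hsubmxK.
Qed.

Program Definition whitney : vbundle :=
  @VBundle whitney_fiber
    [set s | exists t u, [/\ batlas t, batlas u & s = whitney_triv t u]] _ _.
Next Obligation.
move=> p; have [t bt tp] := batlas_cover E p.
have [u bu up] := batlas_cover F p.
by exists (whitney_triv t u) => //; exists t, u.
Qed.
Next Obligation.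
move=> _ _ [t [u [bt bu ->]]] [t' [u' [bt' bu' ->]]] /= i j.
have oW : open ((tdom t `&` tdom u) `&` (tdom t' `&` tdom u')).
  by apply: openI; apply: openI; exact: tdom_open.
have E0 : forall p, tmap (whitney_triv t' u') p (tframe (t := whitney_triv t u) i p) 0 j =
   match fintype.split i, fintype.split j with
   | inl i', inl j' => tmap t' p (tframe i' p) 0 j'
   | inr i', inr j' => tmap u' p (tframe i' p) 0 j'
   | _, _ => 0
   end.
  move=> p; rewrite /tframe /= whitney_tmapE whitney_tinvE /=.
  rewrite -[in LHS](splitK i) -[in LHS](splitK j).
  case: (fintype.split i) (fintype.split j) => i' [] j' /=; rewrite ?row_mxEl ?row_mxEr;
    rewrite ?delta_mx_lshift ?delta_mx_rshift ?row_mxKl ?row_mxKr //=.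
  - by rewrite linear0 linear0 mxE.
  - by rewrite linear0 linear0 mxE.
case: (fintype.split i) (fintype.split j) E0 => i' [] j' E0.
- apply: (smooth_fun_on_eq oW (fun p _ => esym (E0 p))).
  by apply: smooth_fun_on_sub (batlas_compat bt bt' i' j') => p [[? ?] []].
- by apply: (smooth_fun_on_eq oW (fun p _ => esym (E0 p)));
     exact: (smooth_fun_on_cst 0 oW).
- by apply: (smooth_fun_on_eq oW (fun p _ => esym (E0 p)));
     exact: (smooth_fun_on_cst 0 oW).
- apply: (smooth_fun_on_eq oW (fun p _ => esym (E0 p))).
  by apply: smooth_fun_on_sub (batlas_compat bu bu' i' j') => p [[? ?] []].
Qed.
End Whitney.
End VectorBundle.

Arguments vbundle {R} M.

Section LineBundle.
Context {R : realType} {M : manifold R}.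

Definition line_fiber (p : M) : vectType R := R^o.

Definition line_tmap p : 'Hom(line_fiber p, 'rV[R]_1) :=
  linfun (fun a : line_fiber p => const_mx a : 'rV[R]_1).

Definition line_tinv p : 'Hom('rV[R]_1, line_fiber p) :=
  linfun (fun w : 'rV[R]_1 => w 0 0 : line_fiber p).

Lemma line_tmapE p a : line_tmap p a = const_mx a.
Proof. by rewrite linfun_linE// => c x y; apply/rowP => i; rewrite !mxE. Qed.

Lemma line_tinvE p w : line_tinv p w = w 0 0.
Proof. by rewrite linfun_linE// => c x y; rewrite !mxE. Qed.

Program Definition line_triv : triv line_fiber :=
  @Triv R M line_fiber setT 1 line_tmap line_tinv _ _ _.
Next Obligation. exact: openT. Qed.
Next Obligation. by move=> p _ a; rewrite line_tmapE line_tinvE mxE. Qed.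
Next Obligation.
by move=> p _ w; apply/rowP => i; rewrite line_tmapE line_tinvE mxE ord1.
Qed.

Program Definition line_bundle : vbundle M :=
  @VBundle R M line_fiber [set line_triv] _ _.
Next Obligation. by move=> p; exists line_triv. Qed.
Next Obligation.
move=> _ _ -> -> /= i j.
apply: (smooth_fun_on_eq _ _ (@smooth_fun_on_cst R M _ 1 _)).
- by apply: openI; exact: openT.
- by move=> p _; rewrite /tframe /= line_tmapE line_tinvE !mxE !ord1 !eqxx.
- by apply: openI; exact: openT.
Qed.

End LineBundle.

Section Forms.
Context {R : realType} {M : manifold R}.
Variable E : vbundle M.

(* A family of (inhomogeneous) forms on the fibres of [E]: the restriction of
   [w p] to sequences of length [k] is the component of degree [k], evaluated
   on [k] vectors. *)
Definition form := forall p, seq (E p) -> R.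

(* Γ(Λ^k E^* ). *)
Definition kform (k : nat) (w : form) : Prop :=
  [/\ forall p (s : seq (E p)), size s != k -> w p s = 0,
      forall p (s1 s2 : seq (E p)) (a : R) (u v : E p),
        w p (s1 ++ (a *: u + v) :: s2) =
          a * w p (s1 ++ u :: s2) + w p (s1 ++ v :: s2),
      forall p (s1 s2 s3 : seq (E p)) (u : E p),
        w p (s1 ++ u :: s2 ++ u :: s3) = 0 &
      forall t, batlas t -> forall s : seq 'I_(trank t),
        smooth_fun_on (tdom t) (fun p => w p [seq tframe i p | i <- s])].

Definition form0 (f : M -> R) : form := fun p s => if s is [::] then f p else 0.

Definition form1 (a : section (dual E)) : form :=
  fun p s => if s is [:: v] then a p v else 0.

(* All ways of splitting a sequence into two complementary subsequences, with
   the sign of the corresponding shuffle. *)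
Fixpoint unshuffles (V : Type) (s : seq V) : seq (R * seq V * seq V) :=
  if s is v :: s' then
    [seq (c.1.1, v :: c.1.2, c.2) | c <- unshuffles s'] ++
    [seq ((-1) ^+ size c.1.2 * c.1.1, c.1.2, v :: c.2) | c <- unshuffles s']
  else [:: (1, [::], [::])].

(* [(w ∧ h)(v_1, ..., v_n)] is the sum over all shuffles, without factorials:
   for 1-forms, [(w ∧ h)(u, v) = w u * h v - w v * h u]. *)
Definition wedge (w h : form) : form :=
  fun p s => \sum_(c <- unshuffles s) c.1.1 * w p c.1.2 * h p c.2.

Definition iota_form (X : section E) (w : form) : form :=
  fun p s => w p (X p :: s).

(* The covector underlying the component of degree 1. *)
Definition covector (w : form) : section (dual E) :=
  fun p => linfun (fun v : E p => w p [:: v] : R^o) : dual E p.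

End Forms.

Arguments form0 {R M} E f p s.
Arguments form1 {R M E} a p s.
Arguments wedge {R M E} w h p s.
Arguments iota_form {R M E} X w p s.
Arguments covector {R M E}.

Section LieAlgebroid.
Context {R : realType} (M : manifold R).

(* The axioms constrain [lbr] and [anchor] only on smooth sections and smooth
   functions, and only these values are used below.  Smoothness of the bundle
   map [A -> TM] is expressed by its action on Γ(A) and C^∞(M).  That the
   anchor preserves brackets is a consequence: see [anchor_lbr]. *)
Record lie_algebroid := LieAlgebroid {
  lbundle :> vbundle M;
  anchor : forall p, lbundle p -> (M -> R) -> R;
  lbr : section lbundle -> section lbundle -> section lbundle;
  anchor_tangent : forall p (v : lbundle p), tangent_vector p (anchor v);
  anchor_linear : forall p (a : R) (u v : lbundle p) f, smooth_fun f ->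
    anchor (a *: u + v) f = a * anchor u f + anchor v f;
  anchor_smooth : forall X f, smooth_section X -> smooth_fun f ->
    smooth_fun (fun p => anchor (X p) f);
  lbr_smooth : forall X Y, smooth_section X -> smooth_section Y ->
    smooth_section (lbr X Y);
  lbr_linear : forall (a : R) X Y Z,
    smooth_section X -> smooth_section Y -> smooth_section Z ->
    forall p, lbr (fun q => a *: X q + Y q) Z p = a *: lbr X Z p + lbr Y Z p;
  lbr_anti : forall X Y, smooth_section X -> smooth_section Y ->
    forall p, lbr X Y p = - lbr Y X p;
  lbr_jacobi : forall X Y Z,
    smooth_section X -> smooth_section Y -> smooth_section Z ->
    forall p,
      lbr X (lbr Y Z) p + lbr Y (lbr Z X) p + lbr Z (lbr X Y) p = 0;
  lbr_leibniz : forall X Y f,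
    smooth_section X -> smooth_section Y -> smooth_fun f ->
    forall p, lbr X (fun q => f q *: Y q) p =
                f p *: lbr X Y p + anchor (X p) f *: Y p }.

Definition rho (A : lie_algebroid) (X : section A) (f : M -> R) : M -> R :=
  fun p => anchor (X p) f.

Section Schouten.
Variable A : lie_algebroid.

Definition mform := form (dual A).

(* Γ(Λ^k A): Λ^k A is viewed as the k-forms on the dual of A. *)
Definition multisection (k : nat) (D : mform) : Prop := kform k D.

Definition mform1 (X : section A) : mform :=
  fun p s => if s is [:: xi] then xi (X p) else 0.

(* The exponent [a1.+1 * a2.+1] has the parity of [(a1 - 1) * (a2 - 1)]; the
   truncated [(a1 + a2).-1] matters only for two functions, whose bracket
   is 0. *)
Record is_schouten (S : mform -> mform -> mform) : Prop := IsSchouten {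
  schouten_degree : forall a1 a2 D1 D2,
    multisection a1 D1 -> multisection a2 D2 ->
    multisection (a1 + a2).-1 (S D1 D2);
  schouten_linear : forall a1 a2 (c : R) D1 D1' D2,
    multisection a1 D1 -> multisection a1 D1' -> multisection a2 D2 ->
    S (fun p s => c * D1 p s + D1' p s) D2 =
      (fun p s => c * S D1 D2 p s + S D1' D2 p s);
  schouten_functions : forall f g, smooth_fun f -> smooth_fun g ->
    S (form0 (dual A) f) (form0 (dual A) g) = (fun _ _ => 0);
  schouten_function : forall X f, smooth_section X -> smooth_fun f ->
    S (mform1 X) (form0 (dual A) f) = form0 (dual A) (rho X f);
  schouten_sections : forall X Y, smooth_section X -> smooth_section Y ->
    S (mform1 X) (mform1 Y) = mform1 (lbr X Y);
  schouten_wedge : forall a1 a2 a3 D1 D2 D3,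
    multisection a1 D1 -> multisection a2 D2 -> multisection a3 D3 ->
    S D1 (wedge D2 D3) =
      (fun p s => wedge (S D1 D2) D3 p s +
                  (-1) ^+ (a1.+1 * a2) * wedge D2 (S D1 D3) p s);
  schouten_anti : forall a1 a2 D1 D2,
    multisection a1 D1 -> multisection a2 D2 ->
    S D1 D2 = (fun p s => - ((-1) ^+ (a1.+1 * a2.+1) * S D2 D1 p s)) }.

(* The axioms have a solution, unique on multisections; the default value is
   never used. *)
Definition schouten : mform -> mform -> mform :=
  xget (fun _ _ _ _ => 0) [set S | is_schouten S].

End Schouten.

Arguments mform1 {A} X p s.
Arguments schouten {A} D1 D2 p s : rename.

Section Differential.
Variable A : lie_algebroid.

Definition del (T : Type) (i : nat) (s : seq T) := take i s ++ drop i.+1 s.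

Definition values (Xs : seq (section A)) p : seq (A p) := [seq X p | X <- Xs].

Definition dsections (w : form A) (Xs : seq (section A)) : M -> R :=
  let X i := nth (zero_section A) Xs i in
  fun p =>
    \sum_(i < size Xs)
      (-1) ^+ i * rho (X i) (fun q => w q (values (del i Xs) q)) p +
    \sum_(i < size Xs) \sum_(j < size Xs | (i < j)%N)
      (-1) ^+ (i + j) *
      w p (lbr (X i) (X j) p :: values (del i (del j Xs)) p).

Definition extend p (v : A p) : section A :=
  xget (zero_section A) [set X | smooth_section X /\ X p = v].

(* [dsections w] is tensorial when [w] is a smooth form, so that its value at
   [p] does not depend on the extensions. *)
Definition dA (w : form A) : form A :=
  fun p s => dsections w [seq extend v | v <- s] p.

End Differential.

Arguments dA {A} w p s.

Definition is_closed (A : lie_algebroid) (phi : section (dual A)) : Prop :=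
  dA (form1 phi) = (fun _ _ => 0).

Record jacobi_algebroid := JacobiAlgebroid {
  jbase :> lie_algebroid;
  jphi : section (dual jbase);
  jphi_smooth : smooth_section jphi;
  jphi_closed : is_closed jphi }.

Section Jacobi.
Variable J : jacobi_algebroid.

(* [a1] and [a2] are the degrees of [D1] and [D2]. *)
Definition jschouten (a1 a2 : nat) (D1 D2 : mform J) : mform J :=
  fun p s => schouten D1 D2 p s
    + (a1%:R - 1) * wedge D1 (iota_form (@jphi J) D2) p s
    - (-1) ^+ a1.+1 * (a2%:R - 1) * wedge (iota_form (@jphi J) D1) D2 p s.

Definition dJ (w : form J) : form J :=
  fun p s => dA w p s + wedge (form1 (@jphi J)) w p s.

Arguments dJ w p s : clear implicits.

Definition lieJ (X : section J) (w : form J) : form J :=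
  fun p s => iota_form X (dJ w) p s + dJ (iota_form X w) p s.

Definition jacobi_structure (pi : mform J) : Prop :=
  multisection 2 pi /\ jschouten 2 2 pi pi = (fun _ _ => 0).

End Jacobi.

Arguments jschouten {J} a1 a2 D1 D2 p s.
Arguments dJ {J} w p s.
Arguments lieJ {J} X w p s.

Definition poisson_structure (A : lie_algebroid) (pi : mform A) : Prop :=
  multisection 2 pi /\ schouten pi pi = (fun _ _ => 0).

Definition vrel (E F : vbundle M) := forall p, set (E p * F p).

Section Relations.
Variable A : lie_algebroid.

Definition in_rel (E F : vbundle M) (Q : vrel E F)
    (X : section E) (Y : section F) : Prop :=
  [/\ smooth_section X, smooth_section Y & forall p, Q p (X p, Y p)].

Definition dual_rel (E : vbundle M) (Q : vrel E E) : vrel (dual E) (dual E) :=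
  fun p => [set ba : dual E p * dual E p | forall u v : E p, Q p (u, v) -> ba.2 u = ba.1 v].

Definition torsion (X1 Y1 X2 Y2 : section A) (a b c : section (dual A)) :
    M -> R :=
  fun p => a p (lbr Y1 Y2 p) - b p (lbr Y1 X2 p + lbr X1 Y2 p)
           + c p (lbr X1 X2 p).

Definition nijenhuis (Q : vrel A A) : Prop :=
  forall X1 Y1 X2 Y2 a b c,
    in_rel Q X1 Y1 -> in_rel Q X2 Y2 ->
    in_rel (dual_rel Q) a b -> in_rel (dual_rel Q) b c ->
    forall p, torsion X1 Y1 X2 Y2 a b c p = 0.

Definition nrel (L L' : vrel A (dual A)) : vrel A A :=
  fun p => [set xy : A p * A p | exists a : dual A p, L' p (xy.1, a) /\ L p (xy.2, a)].

(* [sharp pi xi] is the vector such that [<eta, sharp pi xi> = pi (xi, eta)]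
   for all [eta]. *)
Definition sharp (pi : mform A) p (xi : dual A p) : A p :=
  xget 0 [set x | forall eta : dual A p, eta x = pi p [:: xi; eta]].

Definition graph_sharp (pi : mform A) : vrel A (dual A) :=
  fun p => [set (sharp pi xi, xi) | xi in setT].

End Relations.

(* A subbundle is locally the span of a smooth frame. *)
Definition subbundle (E : vbundle M) (L : forall p, set (E p)) : Prop :=
  forall p, exists (W : set M) (k : nat) (e : 'I_k -> section E),
    [/\ open W, W p,
        forall i, smooth_section_on W (e i) &
        forall q, W q -> free [tuple e i q | i < k] /\
          L q = [set x | x \in <<[tuple e i q | i < k]>>%VS]].

Section Dirac.
Variable J : jacobi_algebroid.

Let AA : vbundle M := whitney J (dual J).

Definition pair_plus p (e1 e2 : AA p) : R := (e1.2 e2.1 + e2.2 e1.1) / 2.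
Definition pair_minus p (e1 e2 : AA p) : R := (e1.2 e2.1 - e2.2 e1.1) / 2.

Definition courant (e1 e2 : section AA) : section AA :=
  let X p := (e1 p).1 in let xi p := (e1 p).2 in
  let Y p := (e2 p).1 in let eta p := (e2 p).2 in
  let w : form J := fun p s =>
    lieJ X (form1 eta) p s - lieJ Y (form1 xi) p s
    + dJ (form0 J (fun q => pair_minus (e1 q) (e2 q))) p s in
  fun p => (lbr X Y p, covector w p).

Definition isotropic p (W : {vspace AA p}) : Prop :=
  forall e1 e2, e1 \in W -> e2 \in W -> pair_plus e1 e2 = 0.

Definition maximally_isotropic p (L : set (AA p)) : Prop :=
  exists W : {vspace AA p},
    [/\ L = [set x | x \in W], isotropic W &
        forall W' : {vspace AA p}, isotropic W' -> (W <= W')%VS -> W' = W].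

Definition sections_of (L : vrel J (dual J)) (e : section AA) : Prop :=
  smooth_section e /\ forall p, L p (e p).

Definition dirac (L : vrel J (dual J)) : Prop :=
  [/\ subbundle (E := AA) L,
      forall p, maximally_isotropic (L p) &
      forall e1 e2, sections_of L e1 -> sections_of L e2 ->
        sections_of L (courant e1 e2)].

Definition dirac_pair (L L' : vrel J (dual J)) : Prop :=
  [/\ dirac L, dirac L' & nijenhuis (nrel L L')].

Definition jacobi_pair (pi1 pi2 : mform J) : Prop :=
  [/\ jacobi_structure pi1, jacobi_structure pi2 &
      dirac_pair (graph_sharp pi1) (graph_sharp pi2)].

End Dirac.

End LieAlgebroid.

Arguments mform1 {R M A} X p s.
Arguments schouten {R M A} D1 D2 p s : rename.
Arguments dA {R M A} w p s.
Arguments jschouten {R M J} a1 a2 D1 D2 p s.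
Arguments dJ {R M J} w p s.
Arguments lieJ {R M J} X w p s.

Section SmoothSections.
Context {R : realType} {M : manifold R}.

Lemma smooth_funB (f g : M -> R) : smooth_fun f -> smooth_fun g ->
  smooth_fun (fun p => f p - g p).
Proof. exact: smooth_fun_onB openT. Qed.

Lemma smooth_fun_cst (a : R) : smooth_fun (fun _ : M => a).
Proof. exact: smooth_fun_on_cst openT. Qed.

Variable E : vbundle M.
Implicit Types X Y : section E.

Let open_dom (t : triv E) : open (tdom t `&` setT).
Proof. by apply: openI; [exact: tdom_open|exact: openT]. Qed.

Lemma smooth_zero_section : smooth_section (zero_section E).
Proof.
move=> t bt j; apply: smooth_fun_on_eq (smooth_fun_on_cst 0 (open_dom t)) => //.
by move=> p _; rewrite /zero_section linear0 mxE.
Qed.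

Lemma smooth_sectionD X Y : smooth_section X -> smooth_section Y ->
  smooth_section (fun p => X p + Y p).
Proof.
move=> sX sY t bt j.
apply: smooth_fun_on_eq (smooth_fun_onD (open_dom t) (sX _ bt j) (sY _ bt j)).
  exact: open_dom.
by move=> p _; rewrite linearD mxE.
Qed.

Lemma smooth_sectionZ (f : M -> R) X : smooth_fun f -> smooth_section X ->
  smooth_section (fun p => f p *: X p).
Proof.
move=> sf sX t bt j.
have sf' : smooth_fun_on (tdom t `&` setT) f by apply: smooth_fun_on_sub sf.
apply: smooth_fun_on_eq (smooth_fun_onM (open_dom t) sf' (sX _ bt j)).
  exact: open_dom.
by move=> p _; rewrite linearZ mxE.
Qed.

End SmoothSections.

Section SumWithLine.
Context {R : realType} {M : manifold R}.
Implicit Type E : vbundle M.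

Lemma whitney_line_tmapl E (t : triv E) p (x : whitney E line_bundle p) j :
  @whitney_tmap R M E line_bundle t line_triv p x 0 (lshift 1 j) =
  tmap t p x.1 0 j :> R.
Proof.
by have -> := @whitney_tmapE R M E line_bundle t line_triv p x; rewrite row_mxEl.
Qed.

Lemma whitney_line_tmapr E (t : triv E) p (x : whitney E line_bundle p) j :
  @whitney_tmap R M E line_bundle t line_triv p x 0 (rshift (trank t) j) =
  x.2 :> R.
Proof.
have -> := @whitney_tmapE R M E line_bundle t line_triv p x.
by rewrite row_mxEr /= line_tmapE mxE.
Qed.

Lemma smooth_whitney_line E (e : section (whitney E line_bundle)) :
  smooth_section e <->
  smooth_section (E := E) (fun p => (e p).1) /\ smooth_fun (fun p => (e p).2 : R).
Proof.
have dom (t : triv E) : ((tdom t `&` setT) `&` setT : set M) = tdom t `&` setT.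
  by rewrite !setIT.
have od (t : triv E) : open (tdom t `&` setT).
  by apply: openI; [exact: tdom_open|exact: openT].
split=> [se|[s1 s2]].
  have bw t : batlas t -> batlas (v := whitney E line_bundle)
      (@whitney_triv R M E line_bundle t line_triv).
    by move=> bt; exists t, line_triv.
  split.
    move=> t bt j; have := se _ (bw t bt) (lshift 1 j).
    rewrite /= dom; apply: smooth_fun_on_eq => // p _.
    exact: whitney_line_tmapl.
  apply: smooth_fun_on_local => p _; have [t bt tp] := batlas_cover E p.
  exists (tdom t `&` setT); split => //.
  have := se _ (bw t bt) (rshift _ 0).
  rewrite /= dom; apply: smooth_fun_on_eq => // q _.
  exact: whitney_line_tmapr.
move=> _ [t [_ [bt -> ->]]] j; rewrite /= dom.
rewrite -[j]splitK; case: (fintype.split j) => i /=.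
  apply: (smooth_fun_on_eq (od t)) (s1 t bt i) => p _.
  exact/esym/whitney_line_tmapl.
apply: (smooth_fun_on_eq (od t)) (smooth_fun_on_sub _ s2) => // p _.
exact/esym/whitney_line_tmapr.
Qed.

End SumWithLine.

Section LieAlgebroidTheory.
Context {R : realType} {M : manifold R} (A : lie_algebroid M).
Implicit Types X Y Z : section A.

Lemma anchor_f0 p (v : A p) : anchor v (fun=> 0) = 0.
Proof.
have [lin _] := anchor_tangent v.
have := lin 1 _ _ (smooth_fun_cst 0) (smooth_fun_cst 0).
have -> : (fun _ : M => 1 * 0 + 0 : R) = (fun=> 0).
  by apply/funext => q; rewrite mulr0 addr0.
by rewrite mul1r => /eqP; rewrite -subr_eq subrr => /eqP.
Qed.

Lemma anchor_v0 p f : smooth_fun f -> anchor (0 : A p) f = 0.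
Proof.
move=> sf; have /eqP := anchor_linear 1 (0 : A p) 0 sf.
by rewrite scaler0 addr0 mul1r -subr_eq subrr => /eqP.
Qed.

Lemma lbr_linear_r (a : R) X Y Z :
  smooth_section X -> smooth_section Y -> smooth_section Z ->
  forall p, lbr Z (fun q => a *: X q + Y q) p = a *: lbr Z X p + lbr Z Y p.
Proof.
move=> sX sY sZ p.
have sXY : smooth_section (fun q => a *: X q + Y q).
  by apply: smooth_sectionD => //; apply: smooth_sectionZ => //; exact: smooth_fun_cst.
by rewrite lbr_anti// lbr_linear// opprD -scalerN -!lbr_anti.
Qed.

Lemma lbrDr X Y Z : smooth_section X -> smooth_section Y -> smooth_section Z ->
  forall p, lbr Z (fun q => X q + Y q) p = lbr Z X p + lbr Z Y p.
Proof.
move=> sX sY sZ p; rewrite -[lbr Z X p]scale1r -lbr_linear_r//.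
have -> // : (fun q => X q + Y q) = (fun q => 1 *: X q + Y q).
by apply: functional_extensionality_dep => q; rewrite scale1r.
Qed.

Lemma lbrNr X Z : smooth_section X -> smooth_section Z ->
  forall p, lbr Z (fun q => - X q) p = - lbr Z X p.
Proof.
move=> sX sZ p.
have sN : smooth_section (fun q => - X q).
  have -> : (fun q => - X q) = (fun q => -1 *: X q).
    by apply: functional_extensionality_dep => q; rewrite scaleN1r.
  by apply: smooth_sectionZ => //; exact: smooth_fun_cst.
have z : forall q, lbr Z (zero_section A) q = 0.
  have s0 := @smooth_zero_section _ _ A.
  move=> q; have := lbrDr s0 s0 sZ q.
  have -> : (fun q => zero_section A q + zero_section A q) = zero_section A.
    by apply: functional_extensionality_dep => r; rewrite addr0.
  by move=> /eqP; rewrite -subr_eq subrr => /eqP.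
apply/eqP; rewrite -addr_eq0 -lbrDr//; rewrite -(z p); apply/eqP.
have -> // : (fun q => - X q + X q) = zero_section A.
by apply: functional_extensionality_dep => q; rewrite addNr.
Qed.

Lemma lbr_jacobi_l X Y Z :
  smooth_section X -> smooth_section Y -> smooth_section Z ->
  forall p, lbr (lbr X Y) Z p = lbr X (lbr Y Z) p - lbr Y (lbr X Z) p.
Proof.
move=> sX sY sZ p; have sXZ := lbr_smooth sX sZ.
have sXY := lbr_smooth sX sY.
have /eqP := lbr_jacobi sX sY sZ p; rewrite addr_eq0 => /eqP e.
rewrite lbr_anti// -e; congr (_ + _).
have -> : lbr Z X = (fun q => - lbr X Z q).
  by apply: functional_extensionality_dep => q; rewrite lbr_anti.
by rewrite lbrNr.
Qed.

Lemma lbr_lbrZ X Y Z f : smooth_section X -> smooth_section Y ->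
  smooth_section Z -> smooth_fun f ->
  forall p, lbr X (lbr Y (fun q => f q *: Z q)) p =
    f p *: lbr X (lbr Y Z) p + anchor (X p) f *: lbr Y Z p +
    (anchor (Y p) f *: lbr X Z p + anchor (X p) (rho Y f) *: Z p).
Proof.
move=> sX sY sZ sf p.
have sYZ := lbr_smooth sY sZ.
have sYf : smooth_fun (rho Y f) by exact: anchor_smooth.
have -> : lbr Y (fun q => f q *: Z q) =
    (fun q => f q *: lbr Y Z q + rho Y f q *: Z q).
  by apply: functional_extensionality_dep => q; rewrite lbr_leibniz.
by rewrite lbrDr ?lbr_leibniz//; exact: smooth_sectionZ.
Qed.

Lemma anchor_lbr X Y f : smooth_section X -> smooth_section Y -> smooth_fun f ->
  forall p, anchor (lbr X Y p) f =
    anchor (X p) (rho Y f) - anchor (Y p) (rho X f).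
Proof.
move=> sX sY sf p; have sXY := lbr_smooth sX sY.
pose c := anchor (lbr X Y p) f - (anchor (X p) (rho Y f) - anchor (Y p) (rho X f)).
have cZ Z : smooth_section Z -> c *: Z p = 0.
  move=> sZ; have sfZ := smooth_sectionZ sf sZ.
  have := lbr_jacobi_l sX sY sfZ p.
  rewrite lbr_leibniz// !lbr_lbrZ// lbr_jacobi_l// => e.
  rewrite /c !scalerBl.
  move: e; rewrite scalerBr; set a := f p *: lbr X _ p.
  set b := f p *: lbr Y _ p => e; apply/eqP; rewrite subr_eq0; apply/eqP.
  apply: (addrI (a - b)); rewrite e !opprD.
  rewrite [LHS](AC ((2*2)*(2*2)) (1*5*(4*8)*(2*7)*(3*6))) /=.
  by rewrite !subrr !addr0.
have [X0|/eqP X0] := pselect (X p = 0); last first.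
  by apply/eqP; rewrite -subr_eq0 -/c; have /eqP := cZ _ sX; rewrite scaler_eq0 (negPf X0) orbF.
have [Y0|/eqP Y0] := pselect (Y p = 0); last first.
  by apply/eqP; rewrite -subr_eq0 -/c; have /eqP := cZ _ sY; rewrite scaler_eq0 (negPf Y0) orbF.
have [Z0|/eqP Z0] := pselect (lbr X Y p = 0); last first.
  by apply/eqP; rewrite -subr_eq0 -/c; have /eqP := cZ _ sXY; rewrite scaler_eq0 (negPf Z0) orbF.
by rewrite X0 Y0 Z0 !anchor_v0 ?subr0//; exact: anchor_smooth.
Qed.

End LieAlgebroidTheory.

Section SumAlgebroid.
Context {R : realType} {M : manifold R} (A : lie_algebroid M).

Definition plusR_bundle : vbundle M := whitney A line_bundle.

Definition sfst (e : section plusR_bundle) : section A := fun p => (e p).1.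
Definition ssnd (e : section plusR_bundle) : M -> R := fun p => (e p).2.

Definition plusR_anchor p (v : plusR_bundle p) (f : M -> R) : R :=
  anchor v.1 f.

Definition plusR_lbr (e1 e2 : section plusR_bundle) : section plusR_bundle :=
  fun p => (lbr (sfst e1) (sfst e2) p,
            rho (sfst e1) (ssnd e2) p - rho (sfst e2) (ssnd e1) p).

Lemma smooth_sfst e : smooth_section e -> smooth_section (sfst e).
Proof. by move=> /smooth_whitney_line[]. Qed.

Lemma smooth_ssnd e : smooth_section e -> smooth_fun (ssnd e).
Proof. by move=> /smooth_whitney_line[]. Qed.

Lemma rho_smooth (X : section A) f : smooth_section X -> smooth_fun f ->
  smooth_fun (rho X f).
Proof. exact: anchor_smooth. Qed.

Lemma rhoP (X : section A) (a : R) f g p : smooth_fun f -> smooth_fun g ->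
  rho X (fun q => a * f q + g q) p = a * rho X f p + rho X g p.
Proof. by move=> sf sg; have [+ _] := anchor_tangent (X p); apply. Qed.

Lemma rhoM (X : section A) f g p : smooth_fun f -> smooth_fun g ->
  rho X (fun q => f q * g q) p = rho X f p * g p + f p * rho X g p.
Proof. by move=> sf sg; have [_ +] := anchor_tangent (X p); apply. Qed.

Lemma rhoB (X : section A) f g p : smooth_fun f -> smooth_fun g ->
  rho X (fun q => f q - g q) p = rho X f p - rho X g p.
Proof.
move=> sf sg; rewrite addrC -mulN1r -rhoP//.
by congr (rho X _ p); apply/funext => q; rewrite mulN1r addrC.
Qed.

Program Definition plusR : lie_algebroid M :=
  @LieAlgebroid R M plusR_bundle plusR_anchor plusR_lbr _ _ _ _ _ _ _ _.
Next Obligation. by move=> p v; exact: anchor_tangent. Qed.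
Next Obligation. by move=> p a u v f sf; exact: anchor_linear. Qed.
Next Obligation.
by move=> X f sX sf; apply: (rho_smooth (X := sfst X)) => //; exact: smooth_sfst.
Qed.
Next Obligation.
move=> X Y sX sY; apply/smooth_whitney_line; split.
  by apply: lbr_smooth; exact: smooth_sfst.
apply: smooth_funB; apply: rho_smooth.
- exact: smooth_sfst.
- exact: smooth_ssnd.
- exact: smooth_sfst.
- exact: smooth_ssnd.
Qed.
Next Obligation.
move=> a X Y Z /smooth_whitney_line[sX sx] /smooth_whitney_line[sY sy].
move=> /smooth_whitney_line[sZ sz] p; congr pair.
  exact: (lbr_linear a sX sY sZ).
have e1 : rho (sfst (fun q => a *: X q + Y q)) (ssnd Z) p =
    a * rho (sfst X) (ssnd Z) p + rho (sfst Y) (ssnd Z) p.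
  exact: anchor_linear.
have e2 : rho (sfst Z) (ssnd (fun q => a *: X q + Y q)) p =
    a * rho (sfst Z) (ssnd X) p + rho (sfst Z) (ssnd Y) p.
  exact: rhoP.
rewrite {}e1 {}e2 /=; set b1 := rho _ _ p; set b2 := rho _ _ p.
set b3 := rho _ _ p; set b4 := rho _ _ p.
by rewrite /GRing.scale /= opprD addrACA mulrBr.
Qed.
Next Obligation.
move=> X Y /smooth_whitney_line[sX sx] /smooth_whitney_line[sY sy] p.
congr pair; first exact: lbr_anti.
by rewrite /= opprB.
Qed.
Next Obligation.
move=> X Y Z /smooth_whitney_line[sX sx] /smooth_whitney_line[sY sy].
move=> /smooth_whitney_line[sZ sz] p; congr pair.
  exact: (lbr_jacobi sX sY sZ).
have e U V W : smooth_section (sfst U) -> smooth_fun (ssnd U) ->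
    smooth_section (sfst V) -> smooth_fun (ssnd V) ->
    smooth_section (sfst W) -> smooth_fun (ssnd W) ->
  (plusR_lbr U (plusR_lbr V W) p).2 =
    rho (sfst U) (rho (sfst V) (ssnd W)) p
    - rho (sfst U) (rho (sfst W) (ssnd V)) p
    - (rho (sfst V) (rho (sfst W) (ssnd U)) p
       - rho (sfst W) (rho (sfst V) (ssnd U)) p).
  move=> sU su sV sv sW sw; rewrite /= -anchor_lbr//; congr (_ - _).
  by apply: rhoB; exact: rho_smooth.
have -> : 0 = (plusR_lbr X (plusR_lbr Y Z) p).2
    + (plusR_lbr Y (plusR_lbr Z X) p).2 + (plusR_lbr Z (plusR_lbr X Y) p).2
    :> R by rewrite !e//; ring.
by [].
Qed.
Next Obligation.
move=> X Y f /smooth_whitney_line[sX sx] /smooth_whitney_line[sY sy] sf p.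
congr pair; first exact: lbr_leibniz.
have e : rho (sfst X) (ssnd (fun q => f q *: Y q)) p =
    rho (sfst X) f p * ssnd Y p + f p * rho (sfst X) (ssnd Y) p.
  exact: rhoM.
have e' : rho (sfst (fun q => f q *: Y q)) (ssnd X) p =
    f p * rho (sfst Y) (ssnd X) p.
  have := anchor_linear (f p) (sfst Y p) 0 sx.
  by rewrite addr0 anchor_v0// addr0.
rewrite {}e {}e' /= /plusR_anchor /GRing.scale /= /rho /sfst /ssnd.
ring.
Qed.

End SumAlgebroid.

Section Closed.
Context {R : realType} {M : manifold R} (A : lie_algebroid M).

Lemma extend_smooth p (v : A p) : smooth_section (extend v).
Proof.
rewrite /extend; case: xgetP => [X _ []//|_]; exact: smooth_zero_section.
Qed.

Lemma size_del (T : Type) i (s : seq T) : (i < size s)%N ->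
  size (del i s) = (size s).-1.
Proof.
move=> is_; rewrite size_cat size_take size_drop is_.
by case: (size s) is_ => // n; rewrite ltnS => in_; rewrite subSS subnKC.
Qed.

Lemma form1_size (E : vbundle M) (a : section (dual E)) p (s : seq (E p)) :
  size s != 1 -> form1 a p s = 0.
Proof. by case: s => [|v [|]]. Qed.

Lemma is_closedP (a : section (dual A)) :
  (forall X Y, smooth_section X -> smooth_section Y -> forall p,
     rho X (fun q => a q (Y q)) p - rho Y (fun q => a q (X q)) p
     - a p (lbr X Y p) = 0) ->
  is_closed a.
Proof.
move=> H; apply: functional_extensionality_dep => p; apply/funext => s.
rewrite /dA /dsections size_map.
have [s2|s2] := eqVneq (size s) 2.
  case: s s2 => [|u [|v []]]//= _.
  rewrite !big_ord_recl !big_ord0 /= !big_mkcond /= !big_ord_recl !big_ord0 /=.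
  have := H _ _ (extend_smooth u) (extend_smooth v) p.
  rewrite [X in _ -> _ + (_ + (X + _)) = _]big_mkcond /=.
  rewrite !big_ord_recl !big_ord0 /= => e.
  by rewrite -[RHS]e /bump /= expr0 expr1; ring.
rewrite !big1 ?addr0// => i _.
  rewrite big1// => j ij.
  have jn := ltn_ord j; have i1 : (i < (size s).-1)%N.
    by rewrite -subn1 ltn_subRL add1n; exact: leq_ltn_trans ij jn.
  rewrite form1_size ?mulr0//= size_map !size_del ?size_map//.
  have gen n k : n != 2 -> (k < n.-1)%N -> n.-1.-1.+1 != 1.
    by case: n => [|[|[|]]].
  exact: gen s2 i1.
have -> : (fun q => form1 a q (values (del i [seq extend v | v <- s]) q)) =
    (fun=> 0).
  apply/funext => q; rewrite form1_size// size_map size_del size_map//.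
  have gen n k : n != 2 -> (k < n)%N -> n.-1 != 1 by case: n => [|[|[|]]].
  exact: gen s2 (ltn_ord i).
by rewrite /rho anchor_f0 mulr0.
Qed.

End Closed.

Section PlusR.
Context {R : realType} {M : manifold R} (A : lie_algebroid M).

Definition dual_pair (a : section (dual A)) (f : M -> R) :
    section (dual (plusR A)) :=
  fun p => linfun (fun x : plusR A p => a p x.1 + f p * x.2 : R^o).

Definition dual_fst p (xi : dual (plusR A) p) : dual A p :=
  linfun (fun v : A p => xi (v, 0)).

Definition dual_snd p (xi : dual (plusR A) p) : R := xi (0, 1).

Lemma dual_pairE a f p (x : plusR A p) :
  dual_pair a f p x = a p x.1 + f p * x.2.
Proof.
rewrite /dual_pair linfun_linE// => c y z /=.
by rewrite linearP mulrDr scalerDr !addrA (ACl (1*3*2*4)) /GRing.scale /= mulrCA.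
Qed.

Definition phi01 : section (dual (plusR A)) :=
  dual_pair (zero_section (dual A)) (fun=> 1).

Lemma phi01E p (x : plusR A p) : phi01 p x = x.2.
Proof. by rewrite dual_pairE /zero_section lfunE /= add0r mul1r. Qed.

Lemma phi01_smooth : smooth_section phi01.
Proof.
move=> _ [_ [t [_ [bt -> ->]]] <-] j /=.
have oW : open ((tdom t `&` setT) `&` setT : set M).
  by rewrite !setIT; exact: tdom_open.
pose c : R := (delta_mx 0 j : 'rV[R]_(trank t + 1)) 0 (rshift _ 0).
apply: (smooth_fun_on_eq oW) (smooth_fun_on_cst c oW) => p _.
have e := @dual_tmapE R M (plusR A)
  (@whitney_triv R M A line_bundle t line_triv) p (phi01 p) j.
apply/esym; refine (etrans e _).
rewrite phi01E /tframe /=.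
have -> := @whitney_tinvE R M A line_bundle t line_triv p (delta_mx 0 j).
rewrite /= line_tinvE mxE /c; congr (delta_mx 0 j _ (rshift _ _)).
Qed.

Lemma phi01_closed : is_closed phi01.
Proof.
apply: is_closedP => X Y _ _ p; rewrite phi01E /=.
have e (Z : section (plusR A)) : (fun q => phi01 q (Z q)) = ssnd Z.
  by apply/funext => q; rewrite phi01E.
rewrite !e; exact: subrr.
Qed.

Definition plusR_jacobi : jacobi_algebroid M :=
  JacobiAlgebroid phi01_smooth phi01_closed.

Definition plusR_pair (P : mform A) (Q : section A) : mform (plusR A) :=
  fun p s => if s is [:: xi1; xi2] then
    P p [:: dual_fst xi1; dual_fst xi2]
    + dual_snd xi1 * dual_fst xi2 (Q p) - dual_snd xi2 * dual_fst xi1 (Q p)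
  else 0.

Lemma zero_closed : is_closed (zero_section (dual A)).
Proof.
apply: is_closedP => X Y _ _ p.
have e (Z : section A) : (fun q => zero_section (dual A) q (Z q)) = (fun=> 0).
  by apply/funext => q; rewrite /zero_section lfunE.
by rewrite !e /rho !anchor_f0 subrr sub0r /zero_section lfunE oppr0.
Qed.

Definition zero_jacobi : jacobi_algebroid M :=
  JacobiAlgebroid (@smooth_zero_section R M (dual A)) zero_closed.

Definition poisson_pair (pi1 pi2 : mform A) : Prop :=
  [/\ poisson_structure pi1, poisson_structure pi2 &
      dirac_pair (J := zero_jacobi) (graph_sharp pi1) (graph_sharp pi2)].

End PlusR.

(* Main.v *)
Require Import Defs.
From HB Require Import structures.
From mathcomp Require Import all_boot all_order all_algebra.
From mathcomp Require Import all_classical all_reals all_analysis.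
From mathcomp Require Import ring lra.
Import Order.TTheory GRing.Theory Num.Theory numFieldNormedType.Exports.

Set Implicit Arguments.
Unset Strict Implicit.
Unset Printing Implicit Defensive.

Local Open Scope classical_set_scope.
Local Open Scope ring_scope.

(** The graph of a 2-section pi of a Jacobi algebroid (J, phi) is always a
maximally isotropic subbundle, and its sections are the pairs (pi# xi, xi).
So it is a Dirac structure exactly when
  [pi# xi, pi# eta] = pi# {xi, eta}   for all smooth xi and eta,
where {xi, eta}, the covector part of the Courant bracket, is a Koszul bracket
twisted by phi ([koszulE], [dirac_graphP]).

On A ⊕ ℝ with phi = (0, 1), one finds (pi, 0)# (xi, f) = (pi# xi, 0) and
  {(xi, f), (eta, g)} =
    ({xi, eta}, rho(pi# xi) g - rho(pi# eta) f - pi(xi, eta))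
([koszul_plusR]).  Since (pi, 0)# ignores the second component, both graphs
are Dirac at the same time ([dirac_plusR]).  The relation N of the pair on
A ⊕ ℝ is N × {(0, 0)}; its dual leaves the ℝ-components free, and all brackets of
sections (X, 0) have the form ([X, Y], 0), so the torsions agree
([nijenhuis_plusR]).

It remains to see that the conditions on the Schouten brackets are implied by
the Dirac conditions ([dirac_schouten]); on A ⊕ ℝ the terms containing phi
vanish because the contraction of (pi, 0) with (0, 1) is zero.  The point is
the identity [pi, pi](a, b, c) = [jacobiator] pi pi a b c, that is,
  [pi, pi](a, b, c) =
    2 (c [pi# a, pi# b] - rho(pi# a) pi(b, c) + cyclic permutations),
because the right-hand side is, up to the factor 2, the Dirac condition for a
and b paired with c.  Only the axioms of the Schouten bracket are available,
so pi is multiplied near a point p by a cutoff u with u(p) = 1 all of whose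
derivatives along tangent vectors at p are zero.  This changes neither side at
p, and u pi is a finite sum of wedge products X ∧ Y of global smooth sections
([decompose_multisection]), for which the identity follows from the axioms
([schouten_wedge2E]).

Cutoff functions are built from exp(-1/t) ([cutoff_exists]).  They also yield
smooth extensions of vectors and the principle that an operator which is
linear over the smooth functions depends on pointwise values only
([tensorial]); this is what evaluates the differential, which is defined
through arbitrary extensions. *)

(** * Functions flat at the origin *)

Section FlatFunctions.
Context {R : realType}.

(** The function t^(-m) exp(-1/t) for t > 0, extended by 0.  The parameter [m]
makes the family closed under differentiation up to linear combinations. *)
Definition flat (m : nat) (t : R) : R :=
  if 0 < t then t ^- m * expR (- t^-1) else 0.

Lemma flat_le0 m t : t <= 0 -> flat m t = 0.
Proof. by rewrite /flat ltNge => ->. Qed.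

Lemma flat_gt0 m t : 0 < t -> 0 < flat m t.
Proof.
by move=> t0; rewrite /flat t0 mulr_gt0 ?expR_gt0// invr_gt0 exprn_gt0.
Qed.

Lemma flat_bound m t : `|flat m t| <= (m.+2)`!%:R * t ^+ 2.
Proof.
have [t0|t0] := leP t 0.
  by rewrite flat_le0// normr0 mulr_ge0// sqr_ge0.
rewrite ger0_norm ?(ltW (flat_gt0 m t0))// /flat t0 expRN.
rewrite ler_pdivrMr ?expR_gt0//.
have /(expR_ge1Dxn m.+1) : 0 <= t^-1 by rewrite invr_ge0 ltW.
move=> H; have {}H : t^-1 ^+ m.+2 / (m.+2)`!%:R <= expR t^-1.
  by apply: le_trans H; rewrite lerDr.
have f0 : 0 < (m.+2)`!%:R * t ^+ 2 by rewrite mulr_gt0 ?exprn_gt0// ltr0n fact_gt0.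
apply: le_trans (ler_wpM2l (ltW f0) H).
have fn0 : (m.+2)`!%:R != 0 :> R by rewrite pnatr_eq0 -lt0n fact_gt0.
rewrite le_eqVlt; apply/orP; left; apply/eqP.
rewrite -exprVn !exprS; set a := t^-1 ^+ m.
by field; rewrite fn0 gt_eqF.
Qed.

Lemma is_derive_flat m (t : R) :
  is_derive t 1 (flat m) (flat m.+2 t - m%:R * flat m.+1 t).
Proof.
have [t0|t0|->] := ltgtP t 0.
- rewrite !flat_le0 ?ltW// mulr0 subr0.
  apply: (near_eq_is_derive (f := cst 0)).
  near=> s; rewrite flat_le0// ltW//.
  by near: s; exact: lt_nbhsl.
- refine (near_eq_is_derive (f := fun s : R => s ^- m * expR (- s^-1)) _ _).
    near=> s; rewrite /flat; case: ifPn => //.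
    suff -> : 0 < s by [].
    by near: s; exact: lt_nbhsr.
  have tn0 : t != 0 by rewrite gt_eqF.
  have dV : is_derive t 1 (fun s : R => s^-1) (- t ^- 2).
    by apply: is_derive_eq (is_deriveV tn0 (is_derive_id _ _)) _; rewrite [LHS]mulr1.
  have dm : is_derive t 1 (fun s : R => s ^- m) (- m%:R * t ^- m.+1).
    have -> : (fun s : R => s ^- m) = (fun s : R => s^-1) ^+ m.
      by apply/funext => s; rewrite fctE exprVn.
    apply: is_derive_eq (is_deriveX m dV) _.
    rewrite [LHS]mulrN mulNr; congr (- _); rewrite -mulrA; case: m => [|m].
      by rewrite !mul0r.
    by congr (_ * _); rewrite /= exprVn -invfM -exprD addn2.
  have de : is_derive t 1 (fun s : R => expR (- s^-1)) (expR (- t^-1) * t ^- 2).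
    have dN : is_derive t 1 (fun s : R => - s^-1) (t ^- 2).
      by apply: is_derive_eq (is_deriveN dV) _; rewrite opprK.
    apply: is_derive_eq (is_derive1_comp (is_derive_expR _) dN) _.
    by [].
  apply: is_derive_eq (is_deriveM dm de) _.
  rewrite /flat t0 /GRing.scale /= -!exprVn !exprS.
  by set a := t^-1 ^+ m; ring.
(* At 0, the difference quotient is controlled by [flat_bound]. *)
- rewrite !flat_le0// mulr0 subr0.
  have cv : (fun h : R => h^-1 *: (flat m (h *: 1 + 0) - flat m 0)) @ 0^' --> (0 : R).
    apply/cvgrPdist_le => e e0; near=> h.
    have hn0 : h != 0 by near: h; exact: nbhs_dnbhs_neq.
    rewrite sub0r normrN (flat_le0 m (lexx 0)) subr0 addr0 [h *: 1]mulr1 normrZ normfV.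
    rewrite ler_pdivrMl ?normr_gt0//; apply: le_trans (flat_bound m h) _.
    rewrite -real_normK ?num_real// expr2 mulrA [leLHS]mulrC.
    apply: ler_wpM2l => //.
    have f0 : 0 < (m.+2)`!%:R :> R by rewrite ltr0n fact_gt0.
    rewrite -ler_pdivlMl//.
    near: h.
    apply: dnbhs0_le.
    by rewrite mulr_gt0// invr_gt0.
  split; last exact: cvg_lim cv.
  by apply/cvg_ex; exists 0.
Unshelve. all: by end_near. Qed.

End FlatFunctions.

Section Outer.
Context {R : realType} {n : nat}.
Implicit Types (U : set 'rV[R]_n) (f : 'rV[R]_n -> R).

(** Chain rule for a directional derivative, where only the outer function is
required to be differentiable. *)
Lemma is_derive_outer (g : R -> R) f (x v : 'rV[R]_n) (dg : R) :
  derivable f x v -> is_derive (f x) 1 g dg ->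
  is_derive x v (g \o f) (dg * 'D_v f x).
Proof.
move=> df Dg.
pose k (t : R) : R := f (t *: v + x).
have k0 : k 0 = f x by rewrite /k scale0r add0r.
have E (h : 'rV[R]_n -> R) : (fun t : R => t^-1 *: (h (t *: v + x) - h x)) =
    (fun t : R => t^-1 *: ((fun s : R => h (s *: v + x)) (t *: 1 + 0)
                           - (fun s : R => h (s *: v + x)) 0)).
  by apply/funext => t; rewrite addr0 [t *: 1]mulr1 scale0r add0r.
have Dk : is_derive (0 : R) 1 k ('D_v f x).
  by split; [rewrite /derivable -E|rewrite /derive -E].
have Dg' : is_derive (k 0) 1 g dg by rewrite k0.
have [D1 D2] := is_derive1_comp Dg' Dk.
split; first by move: D1; rewrite /derivable (E (g \o f)).
by rewrite /derive (E (g \o f)); exact: D2.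
Qed.

(** Composing with [flat] preserves smoothness; the induction on [k] runs over
all [m] at once, since differentiating raises [m]. *)
Lemma Ck_flat k m U f : open U -> smooth_on U f -> Ck k U (flat m \o f).
Proof.
move=> oU; elim: k m f => [|k IH] m f sf.
  split=> // x Ux; apply: continuous_comp; first exact: (Ck_cont (sf 0%N)).
  have [D _] := is_derive_flat m (f x).
  exact/differentiable_continuous/derivable1_diffP.
split=> [x Ux|i].
  apply: continuous_comp; first exact: (Ck_cont (sf 0%N)).
  have [D _] := is_derive_flat m (f x).
  exact/differentiable_continuous/derivable1_diffP.
have sD j : Ck j U ('D_(delta_mx 0 i) f) by have [_ /(_ i)[_]] := sf j.+1.
have H x : U x -> is_derive x (delta_mx 0 i) (flat m \o f)
    ((flat m.+2 (f x) - m%:R * flat m.+1 (f x)) * 'D_(delta_mx 0 i) f x).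
  move=> Ux; apply: is_derive_outer; last exact: is_derive_flat.
  by have [_ /(_ i)[+ _]] := sf 1%N; apply.
split; first by move=> x /H[].
apply: (@Ck_eq _ _ _ _
  (fun x => (flat m.+2 (f x) + - m%:R * flat m.+1 (f x)) * 'D_(delta_mx 0 i) f x)).
- by [].
- by move=> x /H[_ ->]; rewrite mulNr.
apply: Ck_mul => //; apply: Ck_add => //; first exact: (IH _ _ sf).
apply: Ck_mul => //; [exact: Ck_cst|exact: (IH _ _ sf)].
Qed.

End Outer.

(** * Cutoff functions and extension of sections *)

Section Cutoff.
Context {R : realType} {M : manifold R}.
Implicit Types (W : set M) (p q : M) (b f : M -> R).

(** A smooth function equal to 1 at [p] whose support is contained in [W]: the
open set [V] on which it vanishes covers the complement of [W]. *)
Definition cutoff p W b : Prop :=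
  [/\ smooth_fun b, b p = 1 &
      exists V, [/\ open V, forall q, W q \/ V q & forall q, V q -> b q = 0]].

Lemma smooth_fun_on_sum (I : Type) (r : seq I) W (F : I -> M -> R) : open W ->
  (forall i, smooth_fun_on W (F i)) ->
  smooth_fun_on W (fun p => \sum_(i <- r) F i p).
Proof.
move=> oW sF; elim: r => [|i r IH].
  by apply: smooth_fun_on_eq (smooth_fun_on_cst 0 oW) => // p _; rewrite big_nil.
apply: smooth_fun_on_eq (smooth_fun_onD oW (sF i) IH) => // p _.
by rewrite big_cons.
Qed.

Lemma smooth_fun_onN W f : open W -> smooth_fun_on W f ->
  smooth_fun_on W (fun p => - f p).
Proof.
move=> oW sf.
have sN := smooth_fun_onM oW (smooth_fun_on_cst (-1) oW) sf.
apply: smooth_fun_on_eq sN => //.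
by move=> p _; rewrite mulN1r.
Qed.

Lemma smooth_fun_on_flat m W f : open W -> smooth_fun_on W f ->
  smooth_fun_on W (flat m \o f).
Proof.
move=> oW sf c ac k.
exact: (@Ck_flat R _ k m _ (f \o cinv c) (open_chart_preimage oW) (sf c ac)).
Qed.

Lemma smooth_chart (c : chart M (mdim M)) i : matlas c ->
  smooth_fun_on (cdom c) (fun q => cmap c q 0 i).
Proof. by move=> ac c' ac'; exact: matlas_compat. Qed.

Lemma rV_norm_le n (v : 'rV[R]_n) (r : R) : 0 <= r ->
  (forall i, `|v 0 i| <= r) -> `|v| <= r.
Proof.
move=> r0 H; rewrite [leLHS]/Num.norm /= mx_normrE; apply/bigmax_leP; split => //.
by move=> [i j] _ /=; rewrite ord1.
Qed.

(** In a chart around [p], take [flat] of r^2 - |x - x0|^2.  It is supported in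
a closed ball, whose image in [M] is compact, hence closed by the Hausdorff
property; so the extension by 0 is smooth. *)
Lemma cutoff_exists W p : open W -> W p -> exists b, cutoff p W b.
Proof.
move=> oW Wp; have [c ac cp] := matlas_cover p.
set x0 := cmap c p.
have /nbhs_closedballP[r rO] : nbhs x0 (cimg c `&` cinv c @^-1` W).
  apply: open_nbhs_nbhs; split; first exact: open_chart_preimage.
  by split; [exact: cmap_img|rewrite /= /x0 cmapK].
set K := closed_ball x0 r%:num in rO.
have r0 : 0 < r%:num by [].
have KE x : K x <-> `|x0 - x| <= r%:num by rewrite /K closed_ballE.
have cK : compact K.
  apply: bounded_closed_compact; last exact: closed_ball_closed.
  exists (`|x0| + r%:num); split; first exact: num_real.
  move=> s lts x /KE Kx; apply: le_trans (ltW lts).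
  have -> : x = x0 - (x0 - x) by rewrite opprB addrC subrK.
  by apply: le_trans (ler_normB _ _) _; rewrite lerD2l.
set C := cinv c @` K.
have clC : closed C.
  apply: (compact_closed (@m_hausdorff R M)).
  apply: continuous_compact => //; apply: continuous_in_subspaceT => x.
  by rewrite inE => /rO[cx _]; exact: cinv_cont.
have CW q : C q -> [/\ cdom c q, W q & K (cmap c q)].
  move=> [x Kx <-]; have [cx Wx] := rO _ Kx; rewrite cinvK//.
  by split => //; exact: cinv_dom.
pose Q q := r%:num ^+ 2 - \sum_i (cmap c q 0 i - x0 0 i) ^+ 2.
have sQ : smooth_fun_on (cdom c) Q.
  have oc := cdom_open c.
  apply: smooth_fun_onB => //; first exact: smooth_fun_on_cst.
  apply: smooth_fun_on_sum => // i.
  have si : smooth_fun_on (cdom c) (fun q => cmap c q 0 i - x0 0 i).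
    by apply: smooth_fun_onB => //; [exact: smooth_chart|exact: smooth_fun_on_cst].
  by apply: smooth_fun_on_eq (smooth_fun_onM oc si si) => // q _; rewrite expr2.
have QK q : 0 < Q q -> K (cmap c q).
  rewrite subr_gt0 => lt; apply/KE; apply: rV_norm_le; first exact: ltW.
  move=> i; rewrite !mxE distrC -(ler_pXn2r (n := 2))// ?nnegrE//.
  rewrite real_normK ?num_real//; apply/ltW; apply: le_lt_trans lt.
  by rewrite (bigD1 i)//= lerDl; apply: sumr_ge0 => j _; rewrite sqr_ge0.
have Qp : Q p = r%:num ^+ 2.
  by rewrite /Q big1 ?subr0// => i _; rewrite subrr expr0n.
pose N := flat 0 (r%:num ^+ 2).
have N0 : N != 0 by rewrite gt_eqF// flat_gt0// exprn_gt0.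
pose b q := if pselect (cdom c q) then N^-1 * flat 0 (Q q) else 0.
have bE q : cdom c q -> b q = N^-1 * flat 0 (Q q).
  by rewrite /b; case: pselect.
have bV q : ~ C q -> b q = 0.
  rewrite /b; case: pselect => // cq nC; have [Qq|Qq] := leP (Q q) 0.
    by rewrite flat_le0// mulr0.
  by exfalso; apply: nC; exists (cmap c q); [exact: QK|exact: cmapK].
have oV : open (~` C) by exact: closed_openC.
exists b; split.
- apply: smooth_fun_on_local => q _; have [Cq|nCq] := pselect (C q).
    exists (cdom c); split; first by have [] := CW q Cq.
    have oc := cdom_open c.
    have sNQ := smooth_fun_onM oc (smooth_fun_on_cst N^-1 oc)
      (smooth_fun_on_flat 0 oc sQ).
    apply: smooth_fun_on_eq sNQ => //.
    by move=> q' cq'; rewrite bE.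
  exists (~` C); split => //.
  by apply: smooth_fun_on_eq (smooth_fun_on_cst 0 oV) => // q' /bV ->.
- by rewrite bE// Qp mulVf.
- exists (~` C); split => // q; have [/CW[]|] := pselect (C q); first by left.
  by right.
Qed.

Lemma cutoff_fun p W b f : open W -> cutoff p W b -> smooth_fun_on W f ->
  smooth_fun (fun q => b q * f q).
Proof.
move=> oW [sb _ [V [oV WV bV]]] sf; apply: smooth_fun_on_local => q _.
have [Wq|Vq] := WV q.
  exists W; split => //; apply: smooth_fun_onM => //.
  exact: smooth_fun_on_sub sb.
exists V; split => //; apply: smooth_fun_on_eq (smooth_fun_on_cst 0 oV) => //.
by move=> q' /bV ->; rewrite mul0r.
Qed.

Section Bundle.
Variable E : vbundle M.
Implicit Types X Y : section E.

Lemma smooth_section_on_sub W W' X : W' `<=` W ->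
  smooth_section_on W X -> smooth_section_on W' X.
Proof.
move=> WW' sX t bt j; apply: smooth_fun_on_sub (sX t bt j).
by move=> q [tq /WW' Wq].
Qed.

Lemma smooth_section_on_eq W X Y : open W -> (forall p, W p -> X p = Y p) ->
  smooth_section_on W X -> smooth_section_on W Y.
Proof.
move=> oW XY sX t bt j; apply: smooth_fun_on_eq (sX t bt j).
  by apply: openI => //; exact: tdom_open.
by move=> q [_ /XY ->].
Qed.

Lemma smooth_section_on_local W X :
  (forall p, W p -> exists W', W' p /\ smooth_section_on W' X) ->
  smooth_section_on W X.
Proof.
move=> H t bt j; apply: smooth_fun_on_local => p [tp Wp].
have [W' [W'p sX]] := H p Wp.
by exists (tdom t `&` W'); split; [split|exact: sX].
Qed.

Lemma smooth_section_onZ W f X : open W -> smooth_fun_on W f ->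
  smooth_section_on W X -> smooth_section_on W (fun p => f p *: X p).
Proof.
move=> oW sf sX t bt j.
have oW' : open (tdom t `&` W) by apply: openI => //; exact: tdom_open.
have sf' : smooth_fun_on (tdom t `&` W) f by apply: smooth_fun_on_sub sf => q [].
apply: smooth_fun_on_eq (smooth_fun_onM oW' sf' (sX t bt j)) => //.
by move=> q _; rewrite linearZ mxE.
Qed.

Lemma smooth_section_onD W X Y : open W -> smooth_section_on W X ->
  smooth_section_on W Y -> smooth_section_on W (fun p => X p + Y p).
Proof.
move=> oW sX sY t bt j.
have oW' : open (tdom t `&` W) by apply: openI => //; exact: tdom_open.
apply: smooth_fun_on_eq (smooth_fun_onD oW' (sX t bt j) (sY t bt j)) => //.
by move=> q _; rewrite linearD mxE.
Qed.

Lemma smooth_section_on0 W : open W -> smooth_section_on W (fun p => 0 : E p).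
Proof.
move=> oW t bt j.
have oW' : open (tdom t `&` W) by apply: openI => //; exact: tdom_open.
apply: smooth_fun_on_eq (smooth_fun_on_cst 0 oW') => //.
by move=> q _; rewrite linear0 mxE.
Qed.

Lemma smooth_section_on_sum (I : Type) (r : seq I) W (F : I -> section E) :
  open W -> (forall i, smooth_section_on W (F i)) ->
  smooth_section_on W (fun p => \sum_(i <- r) F i p).
Proof.
move=> oW sF; elim: r => [|i r IH].
  apply: smooth_section_on_eq (smooth_section_on0 oW) => // p _.
  by rewrite big_nil.
apply: smooth_section_on_eq (smooth_section_onD oW (sF i) IH) => // p _.
by rewrite big_cons.
Qed.

Lemma smooth_tframe (t : triv E) i : batlas t ->
  smooth_section_on (tdom t) (tframe (t := t) i).
Proof.
move=> bt t' bt' j; apply: smooth_fun_on_sub (batlas_compat bt bt' i j).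
by move=> q [].
Qed.

Lemma cutoff_section p W b X : open W -> cutoff p W b ->
  smooth_section_on W X -> smooth_section (fun q => b q *: X q).
Proof.
move=> oW [sb _ [V [oV WV bV]]] sX; apply: smooth_section_on_local => q _.
have [Wq|Vq] := WV q.
  exists W; split => //; apply: smooth_section_onZ => //.
  exact: smooth_fun_on_sub sb.
exists V; split => //.
apply: smooth_section_on_eq (smooth_section_on0 oV) => //.
by move=> q' /bV ->; rewrite scale0r.
Qed.

Lemma smooth_extension p (v : E p) :
  exists X : section E, smooth_section X /\ X p = v.
Proof.
have [t bt tp] := batlas_cover E p.
have ot := tdom_open t.
have [b cb] := cutoff_exists ot tp; have [_ b1 _] := cb.
pose X : section E := fun q => \sum_j tmap t p v 0 j *: tframe (t := t) j q.
have sX : smooth_section_on (tdom t) X.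
  apply: smooth_section_on_sum => // j; apply: smooth_section_onZ => //.
    exact: smooth_fun_on_cst.
  exact: smooth_tframe.
exists (fun q => b q *: X q); split; first exact: (cutoff_section ot cb sX).
by rewrite b1 scale1r /X -tmap_expand.
Qed.

End Bundle.

End Cutoff.

(** * Dual bundles, Whitney sums and the map induced by a 2-section *)

Section DualBundle.
Context {R : realType} {M : manifold R}.
Implicit Types (W : set M) (E F : vbundle M).

(** A covector field is smooth when its values on local frames are. *)
Lemma smooth_dualP E W (a : section (dual E)) :
  smooth_section_on W a <->
  forall t, batlas t -> forall j : 'I_(trank t),
    smooth_fun_on (tdom t `&` W) (fun p => a p (tframe j p)).
Proof.
split=> [sa t bt j|sa _ [t bt <-] j].
  have bt' : batlas (v := dual E) (dual_triv t) by exists t.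
  have := sa _ bt' j; rewrite /=.
  by under eq_fun do rewrite dual_tmapE.
by rewrite /=; under eq_fun do rewrite dual_tmapE; exact: sa.
Qed.

(** The frame of [dual_triv t] consists of the coordinate functions of [t]. *)
Lemma tframe_dualE E (t : triv E) j p (v : E p) :
  tframe (t := dual_triv t) j p v = tmap t p v 0 j.
Proof.
rewrite /tframe /= dual_tinvE (bigD1 j)//= mxE !eqxx mul1r big1 ?addr0// => i ij.
by rewrite mxE eqxx (negPf ij) mul0r.
Qed.

Lemma dual_expand E (t : triv E) p (a : dual E p) : tdom t p ->
  a = \sum_j a (tframe j p) *: tframe (t := dual_triv t) j p.
Proof.
move=> tp; rewrite [LHS](tmap_expand (E := dual E) (t := dual_triv t) a tp).
by apply: eq_bigr => j _; rewrite /= dual_tmapE.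
Qed.

Lemma dual_separates E p (x y : E p) :
  (forall a : dual E p, a x = a y) -> x = y.
Proof.
move=> xy; have [t bt tp] := batlas_cover E p.
rewrite (tmap_expand x tp) (tmap_expand y tp); apply: eq_bigr => j _.
by rewrite -!tframe_dualE xy.
Qed.

Lemma smooth_pairing E W (a : section (dual E)) (X : section E) : open W ->
  smooth_section_on W a -> smooth_section_on W X ->
  smooth_fun_on W (fun p => a p (X p)).
Proof.
move=> oW /smooth_dualP sa sX; apply: smooth_fun_on_local => p Wp.
have [t bt tp] := batlas_cover E p.
have oW' : open (tdom t `&` W) by apply: openI => //; exact: tdom_open.
exists (tdom t `&` W); split; first by split.
have := @smooth_fun_on_sum R M _ (index_enum 'I_(trank t)) _ (fun j p =>
  tmap t p (X p) 0 j * a p (tframe j p)) oW'.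
move=> H; apply: smooth_fun_on_eq (H _) => //.
  move=> q [tq _]; rewrite [in RHS](tmap_expand (X q) tq) linear_sum.
  by apply: eq_bigr => j _; rewrite linearZ.
by move=> j; apply: smooth_fun_onM => //; [exact: sX|exact: sa].
Qed.

Lemma smooth_whitney E F W (e : section (whitney E F)) : open W ->
  smooth_section_on W e <->
  smooth_section_on (E := E) W (fun p => (e p).1) /\
  smooth_section_on (E := F) W (fun p => (e p).2).
Proof.
move=> oW; split=> [se|[s1 s2]].
  have bw t u : batlas t -> batlas u -> batlas (v := whitney E F)
      (@whitney_triv R M E F t u) by move=> bt bu; exists t, u.
  split.
    move=> t bt j; apply: smooth_fun_on_local => p [tp Wp].
    have [u bu up] := batlas_cover F p.
    exists (tdom t `&` tdom u `&` W); split; first by split.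
    have oT : open (tdom t `&` tdom u `&` W).
      by apply: openI => //; apply: openI; exact: tdom_open.
    apply: smooth_fun_on_eq (se _ (bw _ _ bt bu) (lshift _ j)) => // q _.
    by have /= -> := @whitney_tmapE R M E F t u q (e q); rewrite row_mxEl.
  move=> u bu j; apply: smooth_fun_on_local => p [up Wp].
  have [t bt tp] := batlas_cover E p.
  exists (tdom t `&` tdom u `&` W); split; first by split.
  have oT : open (tdom t `&` tdom u `&` W).
    by apply: openI => //; apply: openI; exact: tdom_open.
  apply: smooth_fun_on_eq (se _ (bw _ _ bt bu) (rshift _ j)) => // q _.
  by have /= -> := @whitney_tmapE R M E F t u q (e q); rewrite row_mxEr.
move=> _ [t [u [bt bu ->]]] j /=.
have oT : open (tdom t `&` tdom u `&` W).
  by apply: openI => //; apply: openI; exact: tdom_open.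
rewrite -[j]splitK; case: (fintype.split j) => i /=.
  apply: (smooth_fun_on_eq oT) (smooth_fun_on_sub _ (s1 t bt i)) => q.
    by move=> _; have /= -> := @whitney_tmapE R M E F t u q (e q); rewrite row_mxEl.
  by move=> [[]].
apply: (smooth_fun_on_eq oT) (smooth_fun_on_sub _ (s2 u bu i)) => q.
  by move=> _; have /= -> := @whitney_tmapE R M E F t u q (e q); rewrite row_mxEr.
by move=> [[]].
Qed.

Section TwoForm.
Variables (E : vbundle M) (w : Defs.form E).
Hypothesis kw : kform 2 w.

Lemma kform2_size p (s : seq (E p)) : size s != 2 -> w s = 0.
Proof. by move=> s2; case: kw => + _ _ _; apply. Qed.

Lemma kform2Pl p (a : R) (u v x : E p) :
  w [:: a *: u + v; x] = a * w [:: u; x] + w [:: v; x].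
Proof. by case: kw => _ /(_ p [::] [:: x] a u v). Qed.

Lemma kform2Pr p (a : R) (u v x : E p) :
  w [:: x; a *: u + v] = a * w [:: x; u] + w [:: x; v].
Proof. by case: kw => _ /(_ p [:: x] [::] a u v). Qed.

Lemma kform2_alt p (u : E p) : w [:: u; u] = 0.
Proof. by case: kw => _ _ /(_ p [::] [::] [::] u). Qed.

Lemma kform2Dl p (u v x : E p) : w [:: u + v; x] = w [:: u; x] + w [:: v; x].
Proof. by rewrite -[u]scale1r kform2Pl mul1r scale1r. Qed.

Lemma kform2Dr p (u v x : E p) : w [:: x; u + v] = w [:: x; u] + w [:: x; v].
Proof. by rewrite -[u]scale1r kform2Pr mul1r scale1r. Qed.

Lemma kform2_anti p (u v : E p) : w [:: u; v] = - w [:: v; u].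
Proof.
apply/eqP; rewrite -addr_eq0; have := kform2_alt (u + v).
by rewrite kform2Dl !kform2Dr !kform2_alt add0r addr0 => ->.
Qed.

Lemma kform2_0l p (x : E p) : w [:: 0; x] = 0.
Proof. by have /eqP := kform2Dl 0 0 x; rewrite addr0 -subr_eq subrr => /eqP. Qed.

Lemma kform2_suml p (I : Type) (r : seq I) (c : I -> R) (F : I -> E p) x :
  w [:: \sum_(i <- r) c i *: F i; x] = \sum_(i <- r) c i * w [:: F i; x].
Proof.
elim: r => [|i r IH]; first by rewrite !big_nil kform2_0l.
by rewrite !big_cons kform2Pl IH.
Qed.

Lemma kform2_sumr p (I : Type) (r : seq I) (c : I -> R) (F : I -> E p) x :
  w [:: x; \sum_(i <- r) c i *: F i] = \sum_(i <- r) c i * w [:: x; F i].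
Proof.
rewrite kform2_anti kform2_suml -sumrN; apply: eq_bigr => i _.
by rewrite kform2_anti mulrN opprK.
Qed.

Lemma smooth_kform2 W (X Y : section E) : open W ->
  smooth_section_on W X -> smooth_section_on W Y ->
  smooth_fun_on W (fun p => w [:: X p; Y p]).
Proof.
move=> oW sX sY; apply: smooth_fun_on_local => p Wp.
have [t bt tp] := batlas_cover E p.
have oW' : open (tdom t `&` W) by apply: openI => //; exact: tdom_open.
exists (tdom t `&` W); split; first by split.
have H := fun i => @smooth_fun_on_sum R M _ (index_enum 'I_(trank t)) _ (fun j p =>
  tmap t p (X p) 0 i * (tmap t p (Y p) 0 j * w [:: tframe i p; tframe j p])) oW'.
have H' := @smooth_fun_on_sum R M _ (index_enum 'I_(trank t)) _ _ oW'
  (fun i => H i _).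
apply: smooth_fun_on_eq (H' _) => //.
  move=> q [tq _] /=.
  rewrite [in RHS](tmap_expand (X q) tq) [in RHS](tmap_expand (Y q) tq).
  rewrite kform2_suml; apply: eq_bigr => i _; rewrite kform2_sumr mulr_sumr.
  by [].
move=> i j; apply: smooth_fun_onM => //; first exact: sX.
apply: smooth_fun_onM => //; first exact: sY.
have [_ _ _ sw] := kw.
by apply: smooth_fun_on_sub (sw t bt [:: i; j]) => q [].
Qed.

End TwoForm.

Section Sharp.
Variables (A : lie_algebroid M) (pi : mform A).
Hypothesis kpi : multisection 2 pi.

(** The vector required by the definition of [sharp] exists, by expansion in a
local frame. *)
Lemma sharpE p (xi eta : dual A p) : eta (sharp pi xi) = pi [:: xi; eta].
Proof.
rewrite /sharp; case: xgetP => [x _ //|H]; exfalso.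
have [t bt tp] := batlas_cover A p.
apply: (H (\sum_j pi [:: xi; tframe (t := dual_triv t) j p]
                *: tframe (t := t) j p)) => zeta.
rewrite [in RHS](dual_expand zeta tp) (kform2_sumr kpi) linear_sum.
by apply: eq_bigr => j _; rewrite linearZ [LHS]mulrC.
Qed.

Lemma sharp_unique p (xi : dual A p) x :
  (forall eta : dual A p, eta x = pi [:: xi; eta]) -> sharp pi xi = x.
Proof. by move=> H; apply: dual_separates => eta; rewrite sharpE H. Qed.

Lemma sharpP p a (xi eta : dual A p) :
  sharp pi (a *: xi + eta) = a *: sharp pi xi + sharp pi eta.
Proof.
apply: sharp_unique => zeta; rewrite linearP /= !sharpE.
by rewrite (kform2Pl kpi).
Qed.

Lemma sharp_smooth_on W (xi : section (dual A)) : open W ->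
  smooth_section_on W xi -> smooth_section_on W (fun p => sharp pi (xi p)).
Proof.
move=> oW sxi t bt j.
have oW' : open (tdom t `&` W) by apply: openI => //; exact: tdom_open.
have bt' : batlas (v := dual A) (dual_triv t) by exists t.
have s1 : smooth_section_on (tdom t `&` W) xi.
  by apply: smooth_section_on_sub sxi => q [].
have s2 : smooth_section_on (E := dual A) (tdom t `&` W) (tframe (t := dual_triv t) j).
  apply: (@smooth_section_on_sub _ _ (dual A) (tdom t))
    (@smooth_tframe _ _ (dual A) (dual_triv t) j bt') => q.
  by move=> [].
apply: smooth_fun_on_eq (smooth_kform2 kpi oW' s1 s2) => // q _.
by rewrite -sharpE tframe_dualE.
Qed.

Lemma sharp_smooth (xi : section (dual A)) :
  smooth_section xi -> smooth_section (fun p => sharp pi (xi p)).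
Proof. exact: sharp_smooth_on openT. Qed.

End Sharp.
End DualBundle.

(** * Tensoriality and the differential in low degree *)

Section Tensorial.
Context {R : realType} {M : manifold R}.

(** An additive operator, linear over the smooth functions, takes the same value
at [p] on sections that agree at [p]. *)
Lemma tensorial (E : vbundle M) p (D : section E -> R) :
  (forall X Y, smooth_section X -> smooth_section Y ->
     D (fun q => X q + Y q) = D X + D Y) ->
  (forall f X, smooth_fun f -> smooth_section X ->
     D (fun q => f q *: X q) = f p * D X) ->
  forall X Y, smooth_section X -> smooth_section Y -> X p = Y p -> D X = D Y.
Proof.
move=> DD DZ X Y sX sY XY.
have smN (Z : section E) : smooth_section Z -> smooth_section (fun q => (-1) *: Z q).
  by apply: smooth_sectionZ; exact: smooth_fun_cst.
pose Z : section E := fun q => X q + (-1) *: Y q.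
have sZ : smooth_section Z by apply: smooth_sectionD => //; exact: smN.
suff Z0 : D Z = 0.
  have := DD _ _ sX (smN _ sY); rewrite -/Z Z0 DZ//; last exact: smooth_fun_cst.
  by rewrite mulN1r => /esym/eqP; rewrite subr_eq0 => /eqP.
have [t bt tp] := batlas_cover E p.
have ot := tdom_open t.
have [b cb] := cutoff_exists ot tp; have [sb b1 [V [oV WV bV]]] := cb.
(* Z = b^2 Z + (1 - b^2) Z, where b^2 Z is a combination of the global sections
   b e_j with coefficients b Z_j vanishing at p, and 1 - b^2 vanishes at p. *)
pose e j : section E := fun q => b q *: tframe (t := t) j q.
have se j : smooth_section (e j) by apply: (cutoff_section ot cb); exact: smooth_tframe.
pose z j : M -> R := fun q => b q * tmap t q (Z q) 0 j.
have sz j : smooth_fun (z j).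
  apply: (cutoff_fun ot cb); apply: smooth_fun_on_sub (sZ t bt j).
  by move=> q.
have sze j : smooth_section (fun q => z j q *: e j q) by exact: smooth_sectionZ.
have Dsum (r : seq 'I_(trank t)) : D (fun q => \sum_(j <- r) z j q *: e j q) = 0.
  elim: r => [|j r IH].
    have -> : (fun q => \sum_(j <- [::]) z j q *: e j q) =
              (fun q => 0 *: zero_section E q).
      by apply: functional_extensionality_dep => q; rewrite big_nil scale0r.
    rewrite DZ ?mul0r//; first exact: smooth_fun_cst.
    exact: smooth_zero_section.
  have -> : (fun q => \sum_(j <- j :: r) z j q *: e j q) =
     (fun q => z j q *: e j q + \sum_(j <- r) z j q *: e j q).
    by apply: functional_extensionality_dep => q; rewrite big_cons.
  rewrite DD//; last exact: (smooth_section_on_sum _ openT).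
  rewrite IH addr0 DZ// /z /Z XY scaleN1r subrr linear0 mxE mulr0 mul0r.
  by [].
have sb' : smooth_fun (fun q => 1 - b q * b q).
  apply: smooth_funB; first exact: smooth_fun_cst.
  exact: (smooth_fun_onM openT sb sb).
have -> : Z = (fun q => (\sum_j z j q *: e j q) + (1 - b q * b q) *: Z q).
  apply: functional_extensionality_dep => q.
  have -> : \sum_j z j q *: e j q = (b q * b q) *: Z q.
    have [tq|/bV bq] := WV q.
      rewrite [in RHS](tmap_expand (Z q) tq) scaler_sumr.
      by apply: eq_bigr => j _; rewrite !scalerA /z; congr (_ *: _); ring.
    by rewrite bq mul0r scale0r big1// => j _; rewrite /e bq scale0r scaler0.
  by rewrite -scalerDl addrC subrK scale1r.
rewrite DD//.
- by rewrite Dsum DZ// b1 mulr1 subrr mul0r addr0.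
- exact: (smooth_section_on_sum _ openT).
- exact: smooth_sectionZ.
Qed.

Section Differential.
Variable A : lie_algebroid M.
Implicit Types (X Y V : section A) (eta : section (dual A)).

Lemma extendE p (v : A p) : extend v p = v.
Proof.
rewrite /extend; case: xgetP => [X _ []//|H]; exfalso.
by have [X sX] := smooth_extension v; exact: H sX.
Qed.

Lemma smooth_pair eta X : smooth_section eta -> smooth_section X ->
  smooth_fun (fun q => eta q (X q)).
Proof. exact: smooth_pairing openT. Qed.

(** The differential of the 1-form [eta] on two global sections. *)
Definition d1 eta X Y p : R :=
  rho X (fun q => eta q (Y q)) p - rho Y (fun q => eta q (X q)) p
    - eta p (lbr X Y p).

Lemma d1_anti eta X Y p : smooth_section X -> smooth_section Y ->
  d1 eta X Y p = - d1 eta Y X p.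
Proof.
by move=> sX sY; rewrite /d1 lbr_anti// linearN; ring.
Qed.

Lemma rhoD X f g p : smooth_fun f -> smooth_fun g ->
  rho X (fun q => f q + g q) p = rho X f p + rho X g p.
Proof.
move=> sf sg; rewrite -[rho X f p]mul1r -rhoP//.
by congr (rho X _ p); apply/funext => q; rewrite mul1r.
Qed.

Lemma d1_tensor_r eta X Y Y' p : smooth_section eta -> smooth_section X ->
  smooth_section Y -> smooth_section Y' -> Y p = Y' p ->
  d1 eta X Y p = d1 eta X Y' p.
Proof.
move=> seta sX; apply: (tensorial (D := fun Y => d1 eta X Y p)).
  move=> Z Z' sZ sZ'; rewrite /d1.
  have sp := smooth_pair seta.
  have -> : (fun q => eta q (Z q + Z' q)) = (fun q => eta q (Z q) + eta q (Z' q)).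
    by apply/funext => q; rewrite linearD.
  rewrite (rhoD X p (sp _ sZ) (sp _ sZ')) lbrDr// linearD /=.
  have -> : rho (fun q => Z q + Z' q) (fun q => eta q (X q)) p =
      rho Z (fun q => eta q (X q)) p + rho Z' (fun q => eta q (X q)) p.
    rewrite /rho -[Z p]scale1r (anchor_linear _ _ _ (sp _ sX)) mul1r scale1r.
    by [].
  ring.
move=> f Z sf sZ; rewrite /d1.
have sp := smooth_pair seta.
have -> : (fun q => eta q (f q *: Z q)) = (fun q => f q * eta q (Z q)).
  by apply/funext => q; rewrite linearZ.
rewrite (rhoM X p sf (sp _ sZ)) lbr_leibniz// linearD !linearZ /=.
have -> : rho (fun q => f q *: Z q) (fun q => eta q (X q)) p =
    f p * rho Z (fun q => eta q (X q)) p.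
  rewrite /rho -[f p *: Z p]addr0 (anchor_linear _ _ _ (sp _ sX)).
  rewrite (anchor_v0 _ _ (sp _ sX)) addr0.
  by [].
rewrite /rho /GRing.scale /=; ring.
Qed.

(** [dA] is computed with chosen extensions of the two vectors, but any smooth
sections with these values give the same result. *)
Lemma dA_form1 eta X Y p : smooth_section eta -> smooth_section X ->
  smooth_section Y -> dA (form1 eta) p [:: X p; Y p] = d1 eta X Y p.
Proof.
move=> seta sX sY.
have -> : d1 eta X Y p = d1 eta (extend (X p)) (extend (Y p)) p.
  have s1 := extend_smooth (X p); have s2 := extend_smooth (Y p).
  rewrite (@d1_tensor_r _ X Y (extend (Y p))) ?extendE//.
  rewrite d1_anti// [RHS]d1_anti//; congr (- _).
  by apply: d1_tensor_r => //; rewrite extendE.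
rewrite /dA /dsections /=.
rewrite !big_ord_recl !big_ord0 /= !big_mkcond /= !big_ord_recl !big_ord0 /=.
rewrite [X in _ + (_ + (X + _))]big_mkcond /= !big_ord_recl !big_ord0 /=.
by rewrite /d1 /bump /= expr0 expr1; ring.
Qed.

Lemma dA_form0 f p (v : A p) : dA (form0 A f) p [:: v] = anchor v f.
Proof.
rewrite /dA /dsections /= !big_ord_recl !big_ord0 /=.
rewrite big_mkcond /= big_ord_recl big_ord0 /= expr0 mul1r !addr0 /rho extendE.
by [].
Qed.

Lemma wedge11 (a b : section (dual A)) p (u v : A p) :
  wedge (form1 a) (form1 b) p [:: u; v] = a p u * b p v - a p v * b p u.
Proof. by rewrite /wedge /= !big_cons big_nil /=; ring. Qed.

Lemma wedge10 (a : section (dual A)) f p (v : A p) :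
  wedge (form1 a) (form0 A f) p [:: v] = a p v * f p.
Proof. by rewrite /wedge /= !big_cons big_nil /=; ring. Qed.

End Differential.
End Tensorial.

(** * When the graph of a 2-section is a Dirac structure *)

Section DiracGraph.
Context {R : realType} {M : manifold R} (J : jacobi_algebroid M).
Variable pi : mform J.
Hypothesis kpi : multisection 2 pi.
Let AA : vbundle M := whitney J (dual J).
Implicit Types (xi eta : section (dual J)) (X Y V : section J).

(** The section of the graph of [pi] with covector part [xi]. *)
Definition graph_section xi : section AA := fun q => (sharp pi (xi q), xi q).

(** The covector part of the Courant bracket of two sections of the graph. *)
Definition koszul xi eta : section (dual J) :=
  fun p => (courant (graph_section xi) (graph_section eta) p).2.

Let phi := @jphi R M J.

Lemma lieJ_form1 X eta V p : smooth_section X -> smooth_section eta ->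
  smooth_section V ->
  lieJ X (form1 eta) p [:: V p] =
    rho X (fun q => eta q (V q)) p - eta p (lbr X V p)
    + phi p (X p) * eta p (V p).
Proof.
move=> sX seta sV; rewrite /lieJ /iota_form /dJ.
have -> : (fun q (s : seq (J q)) => form1 eta q (X q :: s)) =
    form0 J (fun q => eta q (X q)).
  by apply: functional_extensionality_dep => q; apply/funext => -[|? ?].
rewrite dA_form1// dA_form0 wedge11 wedge10 /d1 /rho; ring.
Qed.

Lemma koszulE xi eta V p : smooth_section xi -> smooth_section eta ->
  smooth_section V ->
  koszul xi eta p (V p) =
    (rho (fun q => sharp pi (xi q)) (fun q => eta q (V q)) p
      - eta p (lbr (fun q => sharp pi (xi q)) V p)
      + phi p (sharp pi (xi p)) * eta p (V p))
    - (rho (fun q => sharp pi (eta q)) (fun q => xi q (V q)) p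
      - xi p (lbr (fun q => sharp pi (eta q)) V p)
      + phi p (sharp pi (eta p)) * xi p (V p))
    - rho V (fun q => pi [:: xi q; eta q]) p
    - phi p (V p) * pi [:: xi p; eta p].
Proof.
move=> sxi seta sV; pose X q := sharp pi (xi q); pose Y q := sharp pi (eta q).
have sX : smooth_section X by exact: sharp_smooth.
have sY : smooth_section Y by exact: sharp_smooth.
have spi : smooth_fun (fun q => pi [:: xi q; eta q]) by exact: (smooth_kform2 kpi openT).
have spN : smooth_fun (fun q => - pi [:: xi q; eta q]) by exact: (smooth_fun_onN openT).
have pm : (fun q => pair_minus (graph_section xi q) (graph_section eta q)) =
    (fun q => - pi [:: xi q; eta q]).
  apply/funext => q; rewrite /pair_minus /= !sharpE// (kform2_anti kpi).
  by field.
(* The formula for a smooth section U; it shows that the form defining the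
   Courant bracket is linear in the vector, so that [covector] computes it. *)
have E U : smooth_section U ->
   lieJ X (form1 eta) p [:: U p] - lieJ Y (form1 xi) p [:: U p] +
     dJ (form0 J (fun q => - pi [:: xi q; eta q])) p [:: U p] =
    (rho X (fun q => eta q (U q)) p - eta p (lbr X U p)
      + phi p (X p) * eta p (U p))
    - (rho Y (fun q => xi q (U q)) p - xi p (lbr Y U p)
      + phi p (Y p) * xi p (U p))
    - rho U (fun q => pi [:: xi q; eta q]) p
    - phi p (U p) * pi [:: xi p; eta p].
  move=> sU; rewrite !lieJ_form1// /dJ dA_form0 wedge10 -/phi.
  have -> : anchor (U p) (fun q => - pi [:: xi q; eta q]) =
      - rho U (fun q => pi [:: xi q; eta q]) p.
    have := rhoB U p (smooth_fun_cst 0) spi; rewrite {2}/rho anchor_f0 sub0r => <-.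
    by congr (anchor _ _); apply/funext => q; rewrite sub0r.
  ring.
rewrite /koszul /courant pm /covector linfun_linE; first exact: E.
move=> a u v; have [U [sU <-]] := smooth_extension u.
have [U' [sU' <-]] := smooth_extension v.
have sZ : smooth_section (fun q => a *: U q).
  by apply: smooth_sectionZ => //; exact: smooth_fun_cst.
have sUU : smooth_section (fun q => a *: U q + U' q).
  exact: smooth_sectionD.
have EU := E _ sUU; cbv beta in EU.
rewrite EU (E _ sU) (E _ sU') !lbr_linear_r//.
have sp := smooth_pair.
have L (Z : section J) (al : section (dual J)) : smooth_section al ->
    rho Z (fun q => al q (a *: U q + U' q)) p =
    a * rho Z (fun q => al q (U q)) p + rho Z (fun q => al q (U' q)) p.
  move=> sal; rewrite -rhoP; [|exact: sp..].
  by congr (rho Z _ p); apply/funext => q; rewrite linearP.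
rewrite !L// !linearP /=.
have -> : rho (fun q => a *: U q + U' q) (fun q => pi [:: xi q; eta q]) p =
    a * rho U (fun q => pi [:: xi q; eta q]) p + rho U' (fun q => pi [:: xi q; eta q]) p.
  exact: anchor_linear.
rewrite /GRing.scale /=; ring.
Qed.

(** The graph of [pi] at [p] as the image of a linear map. *)
Definition graph_map p : 'Hom(dual J p, AA p) :=
  linfun (fun a : dual J p => (sharp pi a, a) : AA p).

Lemma graph_mapE p (a : dual J p) : graph_map p a = (sharp pi a, a).
Proof.
rewrite /graph_map linfun_linE// => c u v.
by congr pair; exact: sharpP.
Qed.

Lemma graph_limg p : graph_sharp pi (p := p) = [set x | x \in limg (graph_map p)].
Proof.
apply/seteqP; split=> [_ [a _ <-]|x /memv_imgP[a _ ->]] /=.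
  by rewrite -graph_mapE; exact/memv_img/memvf.
by exists a => //; rewrite graph_mapE.
Qed.

Lemma graph_maximally_isotropic p : maximally_isotropic (graph_sharp pi (p := p)).
Proof.
exists (limg (graph_map p)); split; first exact: graph_limg.
  move=> _ _ /memv_imgP[a _ ->] /memv_imgP[b _ ->]; rewrite !graph_mapE.
  by rewrite /pair_plus /= !sharpE// (kform2_anti kpi) addNr mul0r.
move=> W' isoW' sW; apply/eqP; rewrite eqEsubv sW andbT.
apply/subvP => x xW'; apply/memv_imgP; exists x.2; first exact: memvf.
rewrite graph_mapE; suff -> : sharp pi x.2 = x.1 by case: (x).
apply: sharp_unique => // eta; have : (graph_map p eta) \in W'.
  by move/subvP: sW; apply; exact/memv_img/memvf.
move=> /(isoW' _ _ xW')/eqP; rewrite graph_mapE /pair_plus /= mulf_eq0.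
rewrite invr_eq0 pnatr_eq0 orbF addrC addr_eq0 sharpE// => /eqP ->.
by rewrite (kform2_anti kpi x.2).
Qed.

Lemma graph_subbundle : subbundle (E := AA) (graph_sharp pi).
Proof.
move=> p; have [t bt tp] := batlas_cover J p.
have bt' : batlas (v := dual J) (dual_triv t) by exists t.
pose eps := tframe (t := dual_triv t).
exists (tdom t), (trank t), (fun i => graph_section (eps i)); split => //.
- exact: tdom_open.
- move=> i; have ot := tdom_open t.
  have se : smooth_section_on (E := dual J) (tdom t) (eps i).
    exact: (@smooth_tframe _ _ (dual J) (dual_triv t) i bt').
  by apply/smooth_whitney => //; split => //=; exact: sharp_smooth_on.
move=> q tq.
set T := [tuple _ | _ < _].
have TE (i : 'I_(trank t)) : T`_i = graph_map q (eps i q).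
  by rewrite graph_mapE -tnth_nth tnth_mktuple.
split.
  apply/freeP => k; under eq_bigr do rewrite TE -linearZ.
  rewrite -linear_sum /= graph_mapE => /(congr1 snd) /= H i.
  have := congr1 (fun a : dual J q => a (tframe i q)) H.
  rewrite /= lfunE /= sum_lfunE (bigD1 i)//= big1 => [|j ji].
    rewrite addr0 scale_lfunE tframe_dualE /tframe tinvK// mxE !eqxx.
    by rewrite /GRing.scale /= mulr1.
  rewrite scale_lfunE tframe_dualE /tframe tinvK// mxE eqxx.
  by rewrite (negPf ji) /GRing.scale /= mulr0.
rewrite graph_limg; suff -> : limg (graph_map q) = <<T>>%VS by [].
apply/vspaceP => x; apply/idP/idP.
  move=> /memv_imgP[a _ ->]; rewrite (dual_expand a tq) linear_sum.
  apply: memv_suml => j _; rewrite linearZ /= -/(eps j q); apply: memvZ.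
  by rewrite -TE; apply: memv_span; rewrite mem_nth// size_tuple.
move: x; apply/subvP/span_subvP => x /tnthP[i ->].
by rewrite (tnth_nth 0) TE; exact/memv_img/memvf.
Qed.

Lemma smooth_graph_section xi : smooth_section xi -> smooth_section (graph_section xi).
Proof.
move=> sxi; apply/(smooth_whitney _ openT); split => //.
exact: sharp_smooth.
Qed.

(** The smooth sections of the graph correspond to the smooth covector fields. *)
Lemma sections_of_graphP (e : section AA) :
  sections_of (graph_sharp pi) e <->
  exists xi, smooth_section xi /\ e = graph_section xi.
Proof.
split=> [[se He]|[xi [sxi ->]]].
  exists (fun p => (e p).2); split.
    by have /(smooth_whitney _ openT)[] := se.
  apply: functional_extensionality_dep => p.
  by have [a _ ea] := He p; rewrite /graph_section -ea.
split; first exact: smooth_graph_section.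
by move=> p; exists (xi p).
Qed.

Lemma dirac_graphP : Defs.dirac (graph_sharp pi) <->
  forall xi eta, smooth_section xi -> smooth_section eta ->
    smooth_section (koszul xi eta) /\
    forall p, lbr (fun q => sharp pi (xi q)) (fun q => sharp pi (eta q)) p =
              sharp pi (koszul xi eta p).
Proof.
split=> [[_ _ H] xi eta sxi seta|H].
  have /sections_of_graphP[z [sz ez]] : sections_of (graph_sharp pi)
      (courant (graph_section xi) (graph_section eta)).
    by apply: H; apply/sections_of_graphP; [exists xi|exists eta].
  have kz : koszul xi eta = z.
    by apply: functional_extensionality_dep => p; rewrite /koszul ez.
  split; first by rewrite kz.
  by move=> p; rewrite kz -[RHS]/(graph_section z p).1 -ez.
split; first exact: graph_subbundle.
  exact: graph_maximally_isotropic.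
move=> _ _ /sections_of_graphP[xi [sxi ->]] /sections_of_graphP[eta [seta ->]].
have [sk Hk] := H _ _ sxi seta; apply/sections_of_graphP.
exists (koszul xi eta); split => //; apply: functional_extensionality_dep => p.
by rewrite /graph_section -Hk.
Qed.

End DiracGraph.

(** * Dirac structures on the sum with the trivial line bundle *)

Section PlusRComparison.
Context {R : realType} {M : manifold R} (A : lie_algebroid M).
Implicit Types (W : set M).

Lemma dual_fstE p (xi : dual (plusR A) p) (v : A p) : dual_fst xi v = xi (v, 0).
Proof.
rewrite /dual_fst linfun_linE// => c x y.
rewrite -linearP; congr (xi _); congr (_, _) => /=.
by rewrite [X in _ = X + _]mulr0 addr0.
Qed.

(** Every covector on A ⊕ ℝ is the pair of its two components. *)
Lemma plusR_dualE p (xi : dual (plusR A) p) (v : A p) (c : R) :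
  xi (v, c) = dual_fst xi v + c * dual_snd xi.
Proof.
rewrite dual_fstE /dual_snd.
have -> : (v, c) = (v, 0) + c *: ((0, 1) : plusR A p) :> plusR A p.
  by congr (_, _) => /=; rewrite ?scaler0 ?addr0// add0r [RHS]mulr1.
by rewrite linearD linearZ.
Qed.

Lemma dual_fstP p (a : R) (xi eta : dual (plusR A) p) :
  dual_fst (a *: xi + eta) = a *: dual_fst xi + dual_fst eta.
Proof.
by apply/lfunP => v; rewrite add_lfunE scale_lfunE !dual_fstE add_lfunE scale_lfunE.
Qed.

Lemma dual_fst_pair (a : section (dual A)) f p : dual_fst (dual_pair a f p) = a p.
Proof. by apply/lfunP => v; rewrite dual_fstE dual_pairE /= mulr0 addr0. Qed.

Lemma dual_snd_pair (a : section (dual A)) f p : dual_snd (dual_pair a f p) = f p.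
Proof. by rewrite /dual_snd dual_pairE /= linear0 add0r mulr1. Qed.

Lemma smooth_dual_plusR W (xi : section (dual (plusR A))) : open W ->
  smooth_section_on W xi <->
  smooth_section_on (E := dual A) W (fun p => dual_fst (xi p)) /\
  smooth_fun_on W (fun p => dual_snd (xi p)).
Proof.
move=> oW.
have tl (t : triv A) (j : 'I_(trank t)) p :
    tframe (t := @whitney_triv R M A line_bundle t line_triv) (lshift 1 j) p =
    (tframe j p, 0).
  have /= e := @whitney_tinvE R M A line_bundle t line_triv p (delta_mx 0 (lshift 1 j)).
  rewrite /tframe /= e delta_mx_lshift row_mxKl row_mxKr line_tinvE mxE.
  by [].
have tr (t : triv A) (j : 'I_1) p :
    tframe (t := @whitney_triv R M A line_bundle t line_triv) (rshift (trank t) j) p =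
    (0, 1).
  have /= e := @whitney_tinvE R M A line_bundle t line_triv p
    (delta_mx 0 (rshift (trank t) j)).
  rewrite /tframe /= e delta_mx_rshift row_mxKl row_mxKr line_tinvE mxE linear0.
  by rewrite !ord1 !eqxx.
have bw (t : triv A) : batlas t -> batlas (v := plusR A)
    (@whitney_triv R M A line_bundle t line_triv).
  by move=> bt; exists t, line_triv.
have oT (t : triv A) : open (tdom t `&` W) by apply: openI => //; exact: tdom_open.
split=> [/smooth_dualP sx|[/smooth_dualP s1 s2]].
  split.
    apply/smooth_dualP => t bt j.
    have /= := sx _ (bw t bt) (lshift 1 j); rewrite setIT.
    by apply: smooth_fun_on_eq => // p _; rewrite dual_fstE tl.
  apply: smooth_fun_on_local => p Wp; have [t bt tp] := batlas_cover A p.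
  exists (tdom t `&` W); split; first by split.
  have /= := sx _ (bw t bt) (rshift (trank t) ord0); rewrite setIT.
  by apply: smooth_fun_on_eq => // q _; rewrite /dual_snd tr.
apply/smooth_dualP => _ [t [_ [bt -> ->]]] j.
rewrite /= setIT -[j]splitK; case: (fintype.split j) => i.
  apply: smooth_fun_on_eq (s1 t bt i) => // p _.
  by rewrite dual_fstE [unsplit _]/= tl.
apply: (smooth_fun_on_eq (oT t)) (smooth_fun_on_sub _ s2) => // p _.
by rewrite /dual_snd [unsplit _]/= tr.
Qed.

Lemma dual_fst_pairf (z : section (dual A)) f :
  (fun q => dual_fst (dual_pair z f q)) = z.
Proof.
by apply: functional_extensionality_dep => q; rewrite dual_fst_pair.
Qed.

Lemma smooth_dual_pair0 (z : section (dual A)) : smooth_section z ->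
  smooth_section (dual_pair z (fun=> 0)).
Proof.
move=> sz; apply/(smooth_dual_plusR _ openT); split.
  by rewrite dual_fst_pairf.
have -> : (fun q => dual_snd (dual_pair z (fun=> 0) q)) = fun=> 0.
  by apply/funext => q; rewrite dual_snd_pair.
exact: smooth_fun_cst.
Qed.

Lemma smooth_plusR (X : section A) (f : M -> R) : smooth_section X ->
  smooth_fun f -> smooth_section (E := plusR A) (fun p => (X p, f p)).
Proof. by move=> sX sf; apply/smooth_whitney_line. Qed.

Lemma dual_fst_surj p (a : dual A p) : exists b : dual (plusR A) p, dual_fst b = a.
Proof.
exists (linfun (fun x : plusR A p => a x.1)).
by apply/lfunP => v; rewrite dual_fstE linfun_linE// => c x y; rewrite -linearP.
Qed.

Lemma rho_cst (X : section A) (c : R) p : rho X (fun=> c) p = 0.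
Proof.
have s1 := @smooth_fun_cst R M 1.
have r1 : rho X (fun=> 1) p = 0.
  have := rhoM X p s1 s1; under eq_fun do rewrite mulr1.
  by rewrite mulr1 mul1r => /eqP; rewrite -subr_eq subrr eq_sym => /eqP.
have -> : (fun _ : M => c) = (fun q : M => c * (fun=> 1) q + (fun=> 0) q).
  by apply/funext => q; rewrite mulr1 addr0.
by rewrite (rhoP X c p s1 (smooth_fun_cst 0)) r1 /rho anchor_f0 mulr0 addr0.
Qed.

Lemma lbr_plusR0 (X Y : section A) p :
  lbr (l := plusR A) (fun q => (X q, 0)) (fun q => (Y q, 0)) p = (lbr X Y p, 0).
Proof.
congr pair; have E (Z : section A) : ssnd (fun p => (Z p, 0)) = fun=> 0 by [].
by rewrite !E !rho_cst subrr.
Qed.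

Variable pi : mform A.
Hypothesis kpi : multisection 2 pi.
(* The 2-section (pi, 0) of A ⊕ ℝ. *)
Local Notation pih := (plusR_pair pi (zero_section A)).

Lemma plusR_pairE p (xi eta : dual (plusR A) p) :
  pih [:: xi; eta] = pi [:: dual_fst xi; dual_fst eta].
Proof. by rewrite /plusR_pair /zero_section !linear0 !mulr0 addr0 subr0. Qed.

Lemma plusR_pair_multisection : multisection (A := plusR A) 2 pih.
Proof.
split.
- by move=> p [|x [|y []]].
- move=> p s1 s2 a u v.
  case: s1 => [|x [|y [|z s1]]]; case: s2 => [|x' [|y' s2]] //=;
    rewrite ?mulr0 ?addr0 //; rewrite -?/(plusR_pair _ _ _) .
  + by have := plusR_pairE; rewrite /= => H; rewrite !H dual_fstP (kform2Pl kpi).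
  + by have := plusR_pairE; rewrite /= => H; rewrite !H dual_fstP (kform2Pr kpi).
- move=> p s1 s2 s3 u.
  case: s1 => [|x [|y [|z s1]]]; case: s2 => [|x' [|y' s2]]; case: s3 => [|x'' s3] //=.
  by have := plusR_pairE; rewrite /= => ->; rewrite (kform2_alt kpi).
move=> t bt; case=> [|i [|j [|k s]]] /=; try exact: (smooth_fun_on_cst 0 (tdom_open t)).
have ot := tdom_open t.
have := @smooth_tframe R M (dual (plusR A)) t i bt.
move=> /(smooth_dual_plusR _ ot)[si _].
have := @smooth_tframe R M (dual (plusR A)) t j bt.
move=> /(smooth_dual_plusR _ ot)[sj _].
apply: smooth_fun_on_eq (smooth_kform2 kpi ot si sj) => // p _.
exact: (esym (plusR_pairE (tframe i p) (tframe j p))).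
Qed.

Let kpih := plusR_pair_multisection.

Lemma sharp_plusR p (xi : dual (plusR A) p) :
  sharp pih xi = (sharp pi (dual_fst xi), 0).
Proof.
apply: sharp_unique => // eta.
by rewrite plusR_pairE plusR_dualE mul0r addr0 sharpE.
Qed.

Lemma sharp_plusR_section (xi : section (dual (plusR A))) :
  (fun q => sharp pih (xi q)) = (fun q => (sharp pi (dual_fst (xi q)), 0)).
Proof. by apply: functional_extensionality_dep => q; rewrite sharp_plusR. Qed.

(** The bracket {(xi, f), (eta, g)} on (A ⊕ ℝ, (0, 1)) evaluated on (v, c): its
first component is {xi, eta}, its second one involves derivatives of f, g. *)
Lemma koszul_plusR (xi eta : section (dual (plusR A))) (c : R) p (v : A p) :
  smooth_section xi -> smooth_section eta ->
  koszul (J := plusR_jacobi A) pih xi eta p (v, c) =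
  koszul (J := zero_jacobi A) pi
    (fun q => dual_fst (xi q)) (fun q => dual_fst (eta q)) p v +
  c * (rho (fun q => sharp pi (dual_fst (xi q))) (fun q => dual_snd (eta q)) p
       - rho (fun q => sharp pi (dual_fst (eta q))) (fun q => dual_snd (xi q)) p
       - pi [:: dual_fst (xi p); dual_fst (eta p)]).
Proof.
move=> sxi seta; have [V [sV <-]] := smooth_extension v.
have [sxi1 sxi2] := (smooth_dual_plusR xi openT).1 sxi.
have [seta1 seta2] := (smooth_dual_plusR eta openT).1 seta.
have sVc := smooth_plusR sV (smooth_fun_cst c).
have -> := @koszulE R M (plusR_jacobi A) pih kpih xi eta _ p sxi seta sVc.
have -> := @koszulE R M (zero_jacobi A) pi kpi _ _ _ p sxi1 seta1 sV.
have fn0 q (u : A q) : @jphi R M (zero_jacobi A) q u = 0.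
  by rewrite /= /zero_section lfunE.
have esharp := sharp_plusR_section.
have epi : (fun q => pih [:: xi q; eta q]) =
    (fun q => pi [:: dual_fst (xi q); dual_fst (eta q)]).
  by apply/funext => q; rewrite plusR_pairE.
have ez (z : section (dual (plusR A))) : (fun q => z q (V q, c)) =
    (fun q => c * dual_snd (z q) + dual_fst (z q) (V q)).
  by apply/funext => q; rewrite plusR_dualE addrC.
have elbr (z : section (dual (plusR A))) :
    lbr (l := plusR A) (fun q => sharp pih (z q)) (fun q => (V q, c)) p =
    (lbr (fun q => sharp pi (dual_fst (z q))) V p, 0).
  rewrite esharp /= /plusR_lbr.
  congr pair; rewrite rho_cst.
  have -> : ssnd (fun p => (sharp pi (dual_fst (z p)), 0)) = fun=> 0 by [].
  by rewrite rho_cst subrr.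
have rhoE (z z' : section (dual (plusR A))) :
    smooth_section (E := dual A) (fun q => dual_fst (z' q)) ->
    smooth_fun (fun q => dual_snd (z' q)) ->
    rho (A := plusR A) (fun q => sharp pih (z q)) (fun q => z' q (V q, c)) p =
    c * rho (fun q => sharp pi (dual_fst (z q))) (fun q => dual_snd (z' q)) p +
    rho (fun q => sharp pi (dual_fst (z q))) (fun q => dual_fst (z' q) (V q)) p.
  move=> s1 s2; rewrite ez esharp -rhoP//; exact: smooth_pair.
have fn q (u : plusR A q) : @jphi R M (plusR_jacobi A) q u = u.2.
  exact: phi01E.
have rhoV (f : M -> R) : rho (A := plusR A) (fun q => (V q, c)) f p = rho V f p by [].
rewrite !fn !fn0 epi rhoV plusR_pairE !elbr !rhoE//.
rewrite !sharp_plusR !plusR_dualE /=; ring.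
Qed.

Lemma dirac_plusR :
  Defs.dirac (J := plusR_jacobi A) (graph_sharp pih) <->
  Defs.dirac (J := zero_jacobi A) (graph_sharp pi).
Proof.
have elbr (xi eta : section (dual (plusR A))) p :
    lbr (l := plusR A) (fun q => sharp pih (xi q)) (fun q => sharp pih (eta q)) p =
    (lbr (fun q => sharp pi (dual_fst (xi q)))
         (fun q => sharp pi (dual_fst (eta q))) p, 0).
  by rewrite !sharp_plusR_section lbr_plusR0.
have kfst (xi eta : section (dual (plusR A))) p :
    smooth_section xi -> smooth_section eta ->
    dual_fst (koszul (J := plusR_jacobi A) pih xi eta p) =
    koszul (J := zero_jacobi A) pi
      (fun q => dual_fst (xi q)) (fun q => dual_fst (eta q)) p.
  move=> sxi seta; apply/lfunP => v.
  by rewrite dual_fstE koszul_plusR// mul0r addr0.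
split=> [/(dirac_graphP (J := plusR_jacobi A) kpih) H|
         /(dirac_graphP (J := zero_jacobi A) kpi) H].
  apply/(dirac_graphP (J := zero_jacobi A) kpi) => xi eta sxi seta.
  have fp := dual_fst_pairf.
  have lift := smooth_dual_pair0.
  have [sk Hk] := H _ _ (lift _ sxi) (lift _ seta).
  have ek p := kfst _ _ p (lift _ sxi) (lift _ seta).
  rewrite !fp in ek.
  split.
    have [+ _] := (smooth_dual_plusR _ openT).1 sk.
    have -> // : (fun p => dual_fst (koszul (J := plusR_jacobi A) pih
        (dual_pair xi (fun=> 0)) (dual_pair eta (fun=> 0)) p)) =
      koszul (J := zero_jacobi A) pi xi eta.
    by apply: functional_extensionality_dep => p; rewrite ek.
  have fs (z : section (dual A)) :
      (fun q => sharp pi (dual_fst (dual_pair z (fun=> 0) q))) =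
      (fun q => sharp pi (z q)).
    by apply: functional_extensionality_dep => q; rewrite dual_fst_pair.
  move=> p; have := Hk p; rewrite elbr !fs sharp_plusR ek.
  by case.
apply/(dirac_graphP (J := plusR_jacobi A) kpih) => xi eta sxi seta.
have [sxi1 sxi2] := (smooth_dual_plusR xi openT).1 sxi.
have [seta1 seta2] := (smooth_dual_plusR eta openT).1 seta.
have [sk Hk] := H _ _ sxi1 seta1; split; last first.
  by move=> p; rewrite elbr sharp_plusR kfst// Hk.
apply/(smooth_dual_plusR _ openT); split.
  have -> // : (fun p => dual_fst (koszul (J := plusR_jacobi A) pih xi eta p)) =
    koszul (J := zero_jacobi A) pi
      (fun q => dual_fst (xi q)) (fun q => dual_fst (eta q)).
  by apply: functional_extensionality_dep => p; rewrite kfst.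
have -> : (fun p => dual_snd (koszul (J := plusR_jacobi A) pih xi eta p)) =
  (fun p => rho (fun q => sharp pi (dual_fst (xi q))) (fun q => dual_snd (eta q)) p
       - rho (fun q => sharp pi (dual_fst (eta q))) (fun q => dual_snd (xi q)) p
       - pi [:: dual_fst (xi p); dual_fst (eta p)]).
  by apply/funext => p; rewrite /dual_snd koszul_plusR// linear0 add0r mul1r.
apply: smooth_funB; last exact: (smooth_kform2 kpi openT).
by apply: smooth_funB; apply: rho_smooth => //; exact: sharp_smooth.
Qed.

End PlusRComparison.

(** * Nijenhuis relations on the sum with the trivial line bundle *)

Section NijenhuisPlusR.
Context {R : realType} {M : manifold R} (A : lie_algebroid M).

Variables pi1 pi2 : mform A.
Hypotheses (k1 : multisection 2 pi1) (k2 : multisection 2 pi2).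
Local Notation hat pi := (plusR_pair pi (zero_section A)).

(** The relation on A ⊕ ℝ is the relation on A times {(0, 0)}. *)
Lemma nijenhuis_plusR :
  nijenhuis (A := plusR A)
    (nrel (A := plusR A) (graph_sharp (hat pi1)) (graph_sharp (hat pi2))) <->
  nijenhuis (nrel (graph_sharp pi1) (graph_sharp pi2)).
Proof.
pose Q := nrel (graph_sharp pi1) (graph_sharp pi2).
pose Qh := nrel (A := plusR A) (graph_sharp (hat pi1)) (graph_sharp (hat pi2)).
have QhE p (x y : plusR A p) : Qh p (x, y) <-> [/\ Q p (x.1, y.1), x.2 = 0 & y.2 = 0].
  split.
    move=> [a [[b _ +] [c _ +]]]; rewrite !sharp_plusR//= => -[<- eb] [<- ec].
    split=> //; exists (dual_fst a); split=> /=.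
      by exists (dual_fst a) => //; rewrite eb.
    by exists (dual_fst a) => //; rewrite ec.
  case: x => x1 x2; case: y => y1 y2 /= [[a [[b _ [<- eb]] [c _ [<- ec]]]] -> ->].
  have [a' ea] := dual_fst_surj a; exists a'; split; exists a' => //=;
    by rewrite sharp_plusR// ea ?eb ?ec.
have dualE p (a b : dual (plusR A) p) : dual_rel Qh (p := p) (b, a) <->
    dual_rel Q (p := p) (dual_fst b, dual_fst a).
  split=> H u v /= Quv.
    by rewrite !dual_fstE; apply: (H (u, 0) (v, 0)); apply/QhE.
  case: u v Quv => u1 u2 [v1 v2] /QhE[/= /H/= Huv -> ->].
  by rewrite !plusR_dualE !mul0r !addr0.
have torE (X1 Y1 X2 Y2 : section A) (a b c : section (dual (plusR A))) p :
    torsion (A := plusR A) (fun q => (X1 q, 0)) (fun q => (Y1 q, 0))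
      (fun q => (X2 q, 0)) (fun q => (Y2 q, 0)) a b c p =
    torsion X1 Y1 X2 Y2 (fun q => dual_fst (a q)) (fun q => dual_fst (b q))
      (fun q => dual_fst (c q)) p.
  by rewrite /torsion !lbr_plusR0 !linearD /= !dual_fstE.
have lift (X : section A) : smooth_section X ->
   smooth_section (E := plusR A) (fun q => (X q, 0)).
  by move=> sX; exact: (smooth_plusR sX (smooth_fun_cst 0)).
split=> H.
  move=> X1 Y1 X2 Y2 a b c [sX1 sY1 Q1] [sX2 sY2 Q2] [sa sb Qab] [_ sc Qbc] p.
  have fp := dual_fst_pairf.
  have dl := smooth_dual_pair0.
  have := torE X1 Y1 X2 Y2 (dual_pair a (fun=> 0)) (dual_pair b (fun=> 0))
    (dual_pair c (fun=> 0)) p.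
  rewrite !fp => <-; apply: H; split; try by [exact: lift|exact: dl].
  - by move=> q; apply/QhE; split => //; exact: Q1.
  - by move=> q; apply/QhE; split => //; exact: Q2.
  - by move=> q; apply/dualE; rewrite !dual_fst_pair; exact: Qab.
  - by move=> q; apply/dualE; rewrite !dual_fst_pair; exact: Qbc.
move=> X1 Y1 X2 Y2 a b c [sX1 sY1 Q1] [sX2 sY2 Q2] [sa sb Qab] [_ sc Qbc] p.
have e1 (X Y : section (plusR A)) : (forall q, Qh q (X q, Y q)) ->
    X = (fun q => (sfst X q, 0)) /\ Y = (fun q => (sfst Y q, 0)).
  move=> QXY; split; apply: functional_extensionality_dep => q;
    have /QhE[_ ] := QXY q; rewrite /sfst.
    by case: (X q) => ? ? /= ->.
  by case: (Y q) => ? ? /= _ ->.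
have [eX1 eY1] := e1 _ _ Q1; have [eX2 eY2] := e1 _ _ Q2.
rewrite eX1 eY1 eX2 eY2 torE; apply: H; split;
  try by [exact: smooth_sfst|exact: ((smooth_dual_plusR _ openT).1 _).1].
- by move=> q; have /QhE[] := Q1 q.
- by move=> q; have /QhE[] := Q2 q.
- by move=> q; apply/dualE; exact: Qab.
- by move=> q; apply/dualE; exact: Qbc.
Qed.
End NijenhuisPlusR.

(** * Flat cutoffs and elementary operations on forms *)

Section Forms.
Context {R : realType} {M : manifold R}.

Lemma tangent_leibniz3 p D (u : M -> R) : tangent_vector p D -> smooth_fun u ->
  D u = 0 -> D (fun q => u q * (u q * u q)) = 0.
Proof.
move=> [_ DM] su Du; rewrite DM//; last exact: (smooth_fun_onM openT).
by rewrite DM// Du !(mul0r, mulr0) addr0 mulr0 addr0.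
Qed.

(** If b is a cutoff at [p] then 2 b - b^2 = 1 - (1 - b)^2 is one whose
derivatives at [p] vanish. *)
Lemma flat_cutoff_exists (W : set M) p : open W -> W p ->
  exists u, cutoff p W u /\ forall D, tangent_vector p D -> D u = 0.
Proof.
move=> oW Wp; have [b [sb b1 [V [oV WV bV]]]] := cutoff_exists oW Wp.
have sbb : smooth_fun (fun q => b q * b q) by exact: (smooth_fun_onM openT).
have s0 := @smooth_fun_cst R M 0.
exists (fun q => 2 * b q - b q * b q); split.
  split.
  - apply: smooth_funB => //; apply: (smooth_fun_onM openT) => //.
    exact: smooth_fun_cst.
  - by rewrite b1; ring.
  - by exists V; split => // q /bV ->; rewrite !mulr0 subrr.
move=> D [DP DM].
have sbbN : smooth_fun (fun q => -1 * (b q * b q) + 0).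
  apply: (smooth_fun_onD openT) => //; apply: (smooth_fun_onM openT) => //.
  exact: smooth_fun_cst.
have -> : (fun q => 2 * b q - b q * b q) =
    (fun q => 2 * b q + (-1 * (b q * b q) + 0)).
  by apply/funext => q; ring.
have D0 : D (fun=> 0) = 0.
  have := DP 1 _ _ s0 s0; under eq_fun do rewrite mulr0 addr0.
  by rewrite mul1r => /eqP; rewrite -subr_eq subrr eq_sym => /eqP.
by rewrite DP// DP// DM// D0 b1; ring.
Qed.

Variable E : vbundle M.
Implicit Types w : Defs.form E.

Lemma kformP k c w w' : kform k w -> kform k w' ->
  kform k (fun p s => c * w p s + w' p s).
Proof.
move=> [h1 h2 h3 h4] [h1' h2' h3' h4']; split.
- by move=> p s sk; rewrite h1// h1'// mulr0 addr0.
- by move=> p s1 s2 a u v; rewrite h2 h2'; ring.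
- by move=> p s1 s2 s3 u; rewrite h3 h3' mulr0 addr0.
move=> t bt s; have ot := tdom_open t; apply: smooth_fun_onD => //; last exact: h4'.
apply: smooth_fun_onM => //; [exact: smooth_fun_on_cst|exact: h4].
Qed.

Lemma kform_zero k : kform k (fun p (_ : seq (E p)) => 0 : R).
Proof.
split=> // [p _ _ a _ _|t bt s]; first by rewrite mulr0 addr0.
exact: (smooth_fun_on_cst 0 (tdom_open t)).
Qed.

Lemma kformM k f w : smooth_fun f -> kform k w ->
  kform k (fun p s => f p * w p s).
Proof.
move=> sf [h1 h2 h3 h4]; split.
- by move=> p s sk; rewrite h1// mulr0.
- by move=> p s1 s2 a u v; rewrite h2; ring.
- by move=> p s1 s2 s3 u; rewrite h3 mulr0.
move=> t bt s; have ot := tdom_open t; apply: smooth_fun_onM => //; last exact: h4.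
exact: smooth_fun_on_sub sf.
Qed.

Lemma kform_form0 f : smooth_fun f -> kform 0 (form0 E f).
Proof.
move=> sf; split.
- by move=> p [].
- by move=> p [|? ?] s2 a u v /=; rewrite mulr0 addr0.
- by move=> p [|? ?].
move=> t bt [|i s]; first exact: smooth_fun_on_sub sf.
exact: (smooth_fun_on_cst 0 (tdom_open t)).
Qed.

(** Only the shuffle putting all vectors on the right contributes. *)
Lemma wedge_form0 f w p s : wedge (form0 E f) w p s = f p * w p s.
Proof.
rewrite /wedge.
suff H : forall s (G : seq (E p) -> R),
    \sum_(c <- unshuffles s) c.1.1 * form0 E f p c.1.2 * G c.2 = f p * G s.
  exact: H.
elim=> {s} [|v s IH] G; first by rewrite big_cons big_nil /=; ring.
rewrite /= big_cat !big_map /= big1 => [|c _]; last by rewrite mulr0 mul0r.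
rewrite add0r -(IH (fun s' => G (v :: s'))); apply: eq_bigr => -[[r s1] s2] _ /=.
by case: s1 => [|? ?] /=; rewrite ?expr0 ?mul1r // !mulr0 !mul0r.
Qed.

Lemma wedge_eq0l w w' p s : (forall s', w p s' = 0) -> wedge w w' p s = 0.
Proof. by move=> w0; rewrite /wedge big1// => c _; rewrite w0 mulr0 mul0r. Qed.

Lemma size_unshuffles (T : Type) (s : seq T) :
  all (fun c : R * seq T * seq T => size c.1.2 + size c.2 == size s)%N (unshuffles s).
Proof.
elim: s => //= v s IH; rewrite all_cat !all_map; apply/andP; split.
  by apply: sub_all IH => c /= /eqP <-.
by apply: sub_all IH => c /= /eqP <-; rewrite addnS.
Qed.

End Forms.

(** * Decomposable 2-sections *)

Section Multisections.
Context {R : realType} {M : manifold R} (A : lie_algebroid M).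
Implicit Types (X Y Z : section A).

Lemma multisection1 X : smooth_section X -> multisection 1 (mform1 X).
Proof.
move=> sX; split.
- by move=> p [|? []].
- move=> p [|x [|? ?]] [|y s2] a u v /=; rewrite ?mulr0 ?addr0//.
  by rewrite lfunE /= lfunE.
- by move=> p [|? [|? ?]] [|? ?] s3 u.
move=> _ [t bt <-] [|i [|j s]] /=; try exact: (smooth_fun_on_cst 0 (tdom_open t)).
have ot := tdom_open t.
have := sX t bt i; rewrite setIT; apply: smooth_fun_on_eq => // p _.
by rewrite tframe_dualE.
Qed.

(** The decomposable 2-section X ∧ Y. *)
Definition wedge2 X Y : mform A := wedge (mform1 X) (mform1 Y).

Lemma wedge2E X Y p (a b : dual A p) :
  wedge2 X Y [:: a; b] = a (X p) * b (Y p) - b (X p) * a (Y p).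
Proof. by rewrite /wedge2 /wedge /= !big_cons big_nil /=; ring. Qed.

Lemma wedge2_size X Y p (s : seq (dual A p)) : size s != 2 -> wedge2 X Y s = 0.
Proof.
move=> s2; rewrite /wedge2 /wedge big1_seq// => c /= cs.
have /allP/(_ _ cs)/eqP := @size_unshuffles R _ s.
case: c {cs} => [[r [|x [|? ?]]] [|y [|? ?]]] /= e;
  rewrite ?(mulr0, mul0r)//.
by rewrite -e in s2.
Qed.

Lemma multisection_wedge2 X Y : smooth_section X -> smooth_section Y ->
  multisection 2 (wedge2 X Y).
Proof.
move=> sX sY.
have sz p (s : seq (dual A p)) : size s != 2 -> wedge2 X Y s = 0 by exact: wedge2_size.
split=> //.
- move=> p s1 s2 a u v.
  have [e|ne] := eqVneq (size s1 + size s2)%N 1%N; last first.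
    by rewrite !sz ?mulr0 ?addr0// size_cat /= addnS.
  case: s1 s2 e => [|x [|? ?]] [|y [|? ?]]//= _;
    rewrite !wedge2E !add_lfunE !scale_lfunE /GRing.scale /=; ring.
- move=> p s1 s2 s3 u.
  have [e|ne] := eqVneq (size s1 + size s2 + size s3)%N 0%N; last first.
    rewrite sz// size_cat /= size_cat /= !addnS addnA; by case: (_ + _)%N ne.
  by case: s1 s2 s3 e => [|? ?] [|? ?] [|? ?]//= _; rewrite wedge2E subrr.
move=> _ [t bt <-] s; have ot := tdom_open t.
have [s2|s2] := eqVneq (size s) 2; last first.
  apply: (smooth_fun_on_eq ot) (smooth_fun_on_cst 0 ot) => p _.
  by rewrite sz// size_map.
case: s s2 => [|i [|j []]]//= _.
have c Z k : smooth_section Z -> smooth_fun_on (tdom t) (fun p => tmap t p (Z p) 0 k).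
  by move=> sZ; have := sZ t bt k; rewrite setIT.
have sm : smooth_fun_on (tdom t) (fun p => tmap t p (X p) 0 i * tmap t p (Y p) 0 j
    - tmap t p (X p) 0 j * tmap t p (Y p) 0 i).
  by apply: smooth_fun_onB => //; apply: smooth_fun_onM => //; exact: c.
apply: (smooth_fun_on_eq ot) sm => p _.
by rewrite wedge2E !tframe_dualE.
Qed.

Lemma wedge21E (D : mform A) Z p (a b c : dual A p) :
  wedge D (mform1 Z) p [:: a; b; c] =
  D p [:: a; b] * c (Z p) - D p [:: a; c] * b (Z p) + D p [:: b; c] * a (Z p).
Proof. by rewrite /wedge /= !big_cons big_nil /=; ring. Qed.

Lemma wedge12E (D : mform A) Z p (a b c : dual A p) :
  wedge (mform1 Z) D p [:: a; b; c] =
  a (Z p) * D p [:: b; c] - b (Z p) * D p [:: a; c] + c (Z p) * D p [:: a; b].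
Proof. by rewrite /wedge /= !big_cons big_nil /=; ring. Qed.

Lemma smooth_comb (f1 f2 : M -> R) X Y : smooth_fun f1 -> smooth_fun f2 ->
  smooth_section X -> smooth_section Y ->
  smooth_section (fun q => f1 q *: X q - f2 q *: Y q).
Proof.
move=> s1 s2 sX sY.
have -> : (fun q => f1 q *: X q - f2 q *: Y q) =
    (fun q => f1 q *: X q + (-1) *: (f2 q *: Y q)).
  by apply: functional_extensionality_dep => q; rewrite scaleN1r.
apply: smooth_sectionD; first exact: smooth_sectionZ.
by apply: smooth_sectionZ; [exact: smooth_fun_cst|exact: smooth_sectionZ].
Qed.

Lemma lbr_combr (f1 f2 : M -> R) X Y Z p : smooth_fun f1 -> smooth_fun f2 ->
  smooth_section X -> smooth_section Y -> smooth_section Z ->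
  lbr Z (fun q => f1 q *: X q - f2 q *: Y q) p =
  (f1 p *: lbr Z X p + rho Z f1 p *: X p) - (f2 p *: lbr Z Y p + rho Z f2 p *: Y p).
Proof.
move=> s1 s2 sX sY sZ.
have sY' : smooth_section (fun q => f2 q *: Y q) by exact: smooth_sectionZ.
have sX' : smooth_section (fun q => f1 q *: X q) by exact: smooth_sectionZ.
have sN : smooth_section (fun q => - (f2 q *: Y q)).
  have -> : (fun q => - (f2 q *: Y q)) = (fun q => (-1) *: (f2 q *: Y q)).
    by apply: functional_extensionality_dep => q; rewrite scaleN1r.
  by apply: smooth_sectionZ => //; exact: smooth_fun_cst.
have := lbrDr sX' sN sZ p; rewrite lbrNr// !lbr_leibniz//.
Qed.

Lemma rho_combl (f1 f2 g : M -> R) X1 X2 p : smooth_fun g ->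
  rho (fun q => f1 q *: X1 q - f2 q *: X2 q) g p =
  f1 p * rho X1 g p - f2 p * rho X2 g p.
Proof.
move=> sg; rewrite /rho addrC -scaleNr anchor_linear//.
rewrite -[f1 p *: X1 p]addr0 anchor_linear// anchor_v0//; ring.
Qed.

(** Bracket of two combinations of sections with function coefficients, paired
with a covector field. *)
Lemma pair_lbr_comb (c : section (dual A)) (f1 f2 g1 g2 : M -> R) X1 X2 Y1 Y2 p :
  smooth_fun f1 -> smooth_fun f2 -> smooth_fun g1 -> smooth_fun g2 ->
  smooth_section X1 -> smooth_section X2 -> smooth_section Y1 -> smooth_section Y2 ->
  c p (lbr (fun q => f1 q *: X1 q - f2 q *: X2 q)
           (fun q => g1 q *: Y1 q - g2 q *: Y2 q) p) =
    (f1 p * g1 p * c p (lbr X1 Y1 p) + f1 p * rho X1 g1 p * c p (Y1 p)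
       - g1 p * rho Y1 f1 p * c p (X1 p))
  - (f1 p * g2 p * c p (lbr X1 Y2 p) + f1 p * rho X1 g2 p * c p (Y2 p)
       - g2 p * rho Y2 f1 p * c p (X1 p))
  - (f2 p * g1 p * c p (lbr X2 Y1 p) + f2 p * rho X2 g1 p * c p (Y1 p)
       - g1 p * rho Y1 f2 p * c p (X2 p))
  + (f2 p * g2 p * c p (lbr X2 Y2 p) + f2 p * rho X2 g2 p * c p (Y2 p)
       - g2 p * rho Y2 f2 p * c p (X2 p)).
Proof.
move=> sf1 sf2 sg1 sg2 sX1 sX2 sY1 sY2.
have sX := smooth_comb sf1 sf2 sX1 sX2.
rewrite lbr_combr// (lbr_anti sX sY1) (lbr_anti sX sY2) !lbr_combr//.
rewrite (lbr_anti sY1 sX1) (lbr_anti sY1 sX2) (lbr_anti sY2 sX1) (lbr_anti sY2 sX2).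
(* Abstracting the values at p leaves an identity of linear algebra. *)
rewrite !rho_combl//; move: (c p) (X1 p) (X2 p) (Y1 p) (Y2 p).
move: (lbr X1 Y1 p) (lbr X1 Y2 p) (lbr X2 Y1 p) (lbr X2 Y2 p).
move: (rho X1 g1 p) (rho X1 g2 p) (rho X2 g1 p) (rho X2 g2 p).
move: (rho Y1 f1 p) (rho Y1 f2 p) (rho Y2 f1 p) (rho Y2 f2 p).
move: (f1 p) (f2 p) (g1 p) (g2 p) => a1 a2 b1 b2 r1 r2 r3 r4 s1 s2 s3 s4.
move=> v11 v12 v21 v22 d x1 x2 y1 y2.
have dD x y : d (x + y) = d x + d y by exact: linearD.
have dN x : d (- x) = - d x by exact: linearN.
have dZ (a : R) x : d (a *: x) = a * d x by exact: linearZ.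
rewrite !(dD, dN, dZ).
ring.
Qed.

Lemma rho_comb (f1 f2 x y z w : M -> R) X1 X2 p :
  smooth_fun x -> smooth_fun y -> smooth_fun z -> smooth_fun w ->
  rho (fun q => f1 q *: X1 q - f2 q *: X2 q) (fun q => x q * y q - z q * w q) p =
  f1 p * (rho X1 x p * y p + x p * rho X1 y p - rho X1 z p * w p - z p * rho X1 w p)
  - f2 p * (rho X2 x p * y p + x p * rho X2 y p - rho X2 z p * w p - z p * rho X2 w p).
Proof.
move=> sx sy sz sw.
have sxy : smooth_fun (fun q => x q * y q) by exact: (smooth_fun_onM openT).
have szw : smooth_fun (fun q => z q * w q) by exact: (smooth_fun_onM openT).
have sg : smooth_fun (fun q => x q * y q - z q * w q) by exact: smooth_funB.
rewrite rho_combl// !rhoB// !rhoM//; ring.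
Qed.

End Multisections.

(** * The Schouten bracket of decomposable 2-sections *)

Section JacobiatorDef.
Context {R : realType} {M : manifold R} (A : lie_algebroid M).
Implicit Types (P Q : mform A) (a b c : section (dual A)).

(** One cyclic term of the polarised expression for [P, Q](a, b, c). *)
Definition jacobiator_term P Q a b c p : R :=
  c p (lbr (fun q => sharp P (a q)) (fun q => sharp Q (b q)) p)
  + c p (lbr (fun q => sharp Q (a q)) (fun q => sharp P (b q)) p)
  - rho (fun q => sharp P (a q)) (fun q => Q q [:: b q; c q]) p
  - rho (fun q => sharp Q (a q)) (fun q => P q [:: b q; c q]) p.

(** The cyclic sum expected to be [P, Q](a, b, c) for 2-sections P and Q. *)
Definition jacobiator P Q a b c p : R :=
  jacobiator_term P Q a b c p + jacobiator_term P Q b c a p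
  + jacobiator_term P Q c a b p.

Lemma jacobiatorC P Q a b c p : jacobiator P Q a b c p = jacobiator Q P a b c p.
Proof. by rewrite /jacobiator /jacobiator_term; ring. Qed.

Lemma multisectionD k P Q : multisection k P -> multisection k Q ->
  multisection k (fun p s => P p s + Q p s).
Proof.
move=> kP kQ; have := kformP 1 kP kQ.
by under [X in kform k X]functional_extensionality_dep => p do
  under eq_fun => s do rewrite mul1r.
Qed.


Lemma sharpD P P' p (xi : dual A p) : multisection 2 P -> multisection 2 P' ->
  sharp (fun q s => P q s + P' q s) xi = sharp P xi + sharp P' xi.
Proof.
move=> kP kP'; apply: sharp_unique; first exact: multisectionD.
by move=> eta; rewrite linearD /= !sharpE.
Qed.

Lemma lbrDl (X Y Z : section A) p : smooth_section X -> smooth_section Y ->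
  smooth_section Z ->
  lbr (fun q => X q + Y q) Z p = lbr X Z p + lbr Y Z p.
Proof.
move=> sX sY sZ; rewrite lbr_anti//; last exact: smooth_sectionD.
by rewrite lbrDr// opprD -!lbr_anti.
Qed.

Lemma jacobiatorDl P P' Q a b c p :
  multisection 2 P -> multisection 2 P' -> multisection 2 Q ->
  smooth_section a -> smooth_section b -> smooth_section c ->
  jacobiator (fun q s => P q s + P' q s) Q a b c p =
  jacobiator P Q a b c p + jacobiator P' Q a b c p.
Proof.
move=> kP kP' kQ.
suff H x y z : smooth_section x -> smooth_section y -> smooth_section z ->
    jacobiator_term (fun q s => P q s + P' q s) Q x y z p =
    jacobiator_term P Q x y z p + jacobiator_term P' Q x y z p.
  by move=> sa sb sc; rewrite /jacobiator !H//; ring.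
move=> sx sy sz; rewrite /jacobiator_term.
have E (w : section (dual A)) : (fun q => sharp (fun q s => P q s + P' q s) (w q)) =
    (fun q => sharp P (w q) + sharp P' (w q)).
  by apply: functional_extensionality_dep => q; rewrite sharpD.
have zD (u v : A p) : z p (u + v) = z p u + z p v by exact: linearD.
have sS (D : mform A) (w : section (dual A)) : multisection 2 D ->
    smooth_section w -> smooth_section (fun q => sharp D (w q)).
  by move=> kD sw; exact: (sharp_smooth kD sw).
have sD (D : mform A) (u v : section (dual A)) : multisection 2 D ->
    smooth_section u -> smooth_section v ->
    smooth_fun (fun q => D q [:: u q; v q]).
  by move=> kD su sv; exact: (smooth_kform2 kD openT su sv).
rewrite !E lbrDl ?lbrDr//; try exact: sS.
rewrite !zD rhoD//; try exact: sD.
have -> : rho (fun q => sharp P (x q) + sharp P' (x q)) (fun q => Q q [:: y q; z q]) p =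
    rho (fun q => sharp P (x q)) (fun q => Q q [:: y q; z q]) p +
    rho (fun q => sharp P' (x q)) (fun q => Q q [:: y q; z q]) p.
  rewrite /rho -[sharp P (x p)]scale1r anchor_linear ?mul1r ?scale1r//.
  exact: sD.
ring.
Qed.

Lemma jacobiator0l Q a b c p : multisection 2 Q ->
  smooth_section a -> smooth_section b -> smooth_section c ->
  jacobiator (fun _ _ => 0) Q a b c p = 0.
Proof.
move=> kQ sa sb sc; have k0 := @kform_zero _ _ (dual A) 2.
have := jacobiatorDl p k0 k0 kQ sa sb sc.
have -> : (fun (q : M) (s : seq (dual A q)) => 0 + 0 : R) = (fun _ _ => 0).
  by apply: functional_extensionality_dep => q; apply/funext => s; rewrite addr0.
by move=> /eqP; rewrite -subr_eq subrr eq_sym => /eqP.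
Qed.

Lemma sharp_wedge2 (X Y : section A) p (a : dual A p) :
  smooth_section X -> smooth_section Y ->
  sharp (wedge2 X Y) a = a (X p) *: Y p - a (Y p) *: X p.
Proof.
move=> sX sY; apply: sharp_unique; first exact: multisection_wedge2.
move=> eta; rewrite wedge2E.
have D (u v : A p) : eta (u - v) = eta u - eta v by exact: linearB.
have Z (r : R) (u : A p) : eta (r *: u) = r * eta u by exact: linearZ.
by rewrite D !Z; ring.
Qed.

Section Schouten.
Variable S : mform A -> mform A -> mform A.
Hypothesis hS : is_schouten S.

Lemma schouten_section_wedge2 (X Y Z : section A) :
  smooth_section X -> smooth_section Y -> smooth_section Z ->
  S (mform1 Z) (wedge2 X Y) =
  (fun p s => wedge2 (lbr Z X) Y s + wedge2 X (lbr Z Y) s).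
Proof.
move=> sX sY sZ.
rewrite /wedge2 (schouten_wedge hS (multisection1 sZ) (multisection1 sX)
  (multisection1 sY)).
apply: functional_extensionality_dep => p; apply/funext => s.
by rewrite !(schouten_sections hS)// expr2 mulrNN mulr1 mul1r.
Qed.

Lemma schouten_wedge2_section (X Y Z : section A) :
  smooth_section X -> smooth_section Y -> smooth_section Z ->
  S (wedge2 X Y) (mform1 Z) =
  (fun p s => - (wedge2 (lbr Z X) Y s + wedge2 X (lbr Z Y) s)).
Proof.
move=> sX sY sZ.
rewrite (schouten_anti hS (multisection_wedge2 sX sY) (multisection1 sZ)).
rewrite schouten_section_wedge2//.
apply: functional_extensionality_dep => p; apply/funext => s.
by rewrite -signr_odd /= expr0 mul1r.
Qed.

(** On decomposable 2-sections the axioms of the Schouten bracket determine its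
value, which is the [jacobiator]: after expanding all brackets, the derivatives
of the coefficients cancel. *)
Lemma schouten_wedge2E (X Y Z W : section A) a b c p :
  smooth_section X -> smooth_section Y -> smooth_section Z -> smooth_section W ->
  smooth_section a -> smooth_section b -> smooth_section c ->
  S (wedge2 X Y) (wedge2 Z W) [:: a p; b p; c p] =
  jacobiator (wedge2 X Y) (wedge2 Z W) a b c p.
Proof.
move=> sX sY sZ sW sa sb sc.
have kXY := multisection_wedge2 sX sY.
rewrite [wedge2 Z W]/wedge2 (schouten_wedge hS kXY (multisection1 sZ) (multisection1 sW)).
rewrite !schouten_wedge2_section// -signr_odd /= expr1 wedge21E wedge12E !wedge2E.
rewrite -/(wedge2 Z W) /jacobiator /jacobiator_term.
have E (U V : section A) (w : section (dual A)) : smooth_section U -> smooth_section V ->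
    (fun q => sharp (wedge2 U V) (w q)) =
    (fun q => (fun q => w q (U q)) q *: V q - (fun q => w q (V q)) q *: U q).
  by move=> sU sV; apply: functional_extensionality_dep => q; rewrite sharp_wedge2.
have E2 (U V : section A) (v w : section (dual A)) :
    (fun q => wedge2 U V [:: v q; w q]) =
    (fun q => (fun q => v q (U q)) q * (fun q => w q (V q)) q
              - (fun q => w q (U q)) q * (fun q => v q (V q)) q).
  by apply/funext => q; rewrite wedge2E.
rewrite !E// !E2.
have sp := smooth_pair.
rewrite !pair_lbr_comb ?rho_comb; try by [exact: sp|].
(* The bracket axioms produce [Z, X], [Z, Y], [W, X] and [W, Y]; the remaining
   brackets are brought to this order. *)
rewrite !(@lbr_anti _ _ _ X Z)// !(@lbr_anti _ _ _ X W)//.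
rewrite !(@lbr_anti _ _ _ Y Z)// !(@lbr_anti _ _ _ Y W)//.
have aN (u : A p) : a p (- u) = - a p u by exact: linearN.
have bN (u : A p) : b p (- u) = - b p u by exact: linearN.
have cN (u : A p) : c p (- u) = - c p u by exact: linearN.
rewrite !(aN, bN, cN).
ring.
Qed.
End Schouten.

End JacobiatorDef.

(** * Locality of the Schouten bracket *)

Section Decompose.
Context {R : realType} {M : manifold R} (A : lie_algebroid M).
Implicit Types (P Q : mform A) (a b c : section (dual A)).

(** The finite sum of the decomposable 2-sections X_i ∧ Y_i. *)
Definition wedge2_sum (I : Type) (r : seq I) (X Y : I -> section A) : mform A :=
  fun p s => \sum_(i <- r) wedge2 (X i) (Y i) s.

Lemma wedge2_sum_nil I (X Y : I -> section A) :
  wedge2_sum [::] X Y = (fun _ _ => 0).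
Proof.
apply: functional_extensionality_dep => p; apply/funext => s.
by rewrite /wedge2_sum big_nil.
Qed.

Lemma wedge2_sum_cons I i r (X Y : I -> section A) :
  wedge2_sum (i :: r) X Y = (fun p s => wedge2 (X i) (Y i) s + wedge2_sum r X Y s).
Proof.
apply: functional_extensionality_dep => p; apply/funext => s.
by rewrite /wedge2_sum big_cons.
Qed.

Lemma multisection_wedge2_sum I r (X Y : I -> section A) :
  (forall i, smooth_section (X i)) -> (forall i, smooth_section (Y i)) ->
  multisection 2 (wedge2_sum r X Y).
Proof.
move=> sX sY; elim: r => [|i r IH].
  by rewrite wedge2_sum_nil; exact: kform_zero.
by rewrite wedge2_sum_cons; apply: multisectionD => //; exact: multisection_wedge2.
Qed.

(** Near [p], a 2-section is a combination of wedge products of frame sections.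
Multiplying by the cube of a cutoff v makes the two frame sections and the
coefficient global; the cube still is 1 and has no derivative at [p]. *)
Lemma decompose_multisection P p : multisection 2 P ->
  exists u : M -> R, [/\ smooth_fun u, u p = 1,
    forall D, tangent_vector p D -> D u = 0 &
    exists (I : Type) (r : seq I) (X Y : I -> section A),
      [/\ forall i, smooth_section (X i), forall i, smooth_section (Y i) &
          (fun q s => u q * P q s) = wedge2_sum r X Y]].
Proof.
move=> kP; have [t bt tp] := batlas_cover A p.
have ot := tdom_open t.
have [v [cv Dv]] := flat_cutoff_exists ot tp.
have [sv v1 [V [oV WV vV]]] := cv.
exists (fun q => v q * (v q * v q)); split.
- by apply: (smooth_fun_onM openT) => //; exact: (smooth_fun_onM openT).
- by rewrite v1 !mulr1.
- by move=> D TD; exact: (tangent_leibniz3 TD sv (Dv _ TD)).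
pose eps := tframe (t := dual_triv t).
pose e j : section A := fun q => v q *: tframe (t := t) j q.
have se j : smooth_section (e j) by apply: (cutoff_section ot cv); exact: smooth_tframe.
(* The factor 1/2 compensates that the sum is over all pairs (i, j). *)
pose z (i j : 'I_(trank t)) q := v q * (2^-1 * P q [:: eps i q; eps j q]).
have sz i j : smooth_fun (z i j).
  apply: (cutoff_fun ot cv); apply: smooth_fun_onM => //.
    exact: smooth_fun_on_cst.
  have bt' : batlas (v := dual A) (dual_triv t) by exists t.
  by have [_ _ _ /(_ _ bt' [:: i; j])] := kP.
exists ('I_(trank t) * 'I_(trank t))%type, (index_enum _),
  (fun ij q => z ij.1 ij.2 q *: e ij.1 q), (fun ij => e ij.2); split.
- by move=> ij; exact: smooth_sectionZ.
- by [].
apply: functional_extensionality_dep => q; apply/funext => s.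
have [s2|s2] := eqVneq (size s) 2; last first.
  rewrite (kform2_size kP)// mulr0 /wedge2_sum big1// => i _.
  by rewrite wedge2_size.
case: s s2 => [|a [|b [|? ?]]]//= _.
have [tq|Vq] := WV q; last first.
  rewrite (vV _ Vq) !mul0r /wedge2_sum big1// => i _.
  by rewrite wedge2E /e (vV _ Vq) !scale0r scaler0 !linear0 !(mul0r, mulr0) subrr.
have PE (x y : dual A q) : P q [:: x; y] =
    \sum_i \sum_j x (tframe i q) * y (tframe j q) * P q [:: eps i q; eps j q].
  rewrite {1}(dual_expand x tq) {1}(dual_expand y tq).
  rewrite (kform2_suml kP); apply: eq_bigr => i _.
  by rewrite (kform2_sumr kP) mulr_sumr; apply: eq_bigr => j _; rewrite mulrA.
have -> : P q [:: a; b] = 2^-1 * (P q [:: a; b] - P q [:: b; a]).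
  by rewrite (kform2_anti kP b); field.
rewrite !PE -sumrB mulr_sumr mulr_sumr.
rewrite /wedge2_sum -(pair_bigA _ (fun i j =>
  wedge2 (fun q => z i j q *: e i q) (e j) [:: a; b])) /=.
apply: eq_bigr => i _; rewrite -sumrB !mulr_sumr; apply: eq_bigr => j _.
have aZ (r : R) (x : A q) : a (r *: x) = r * a x by exact: linearZ.
have bZ (r : R) (x : A q) : b (r *: x) = r * b x by exact: linearZ.
rewrite wedge2E /e /z !(aZ, bZ); ring.
Qed.

Section SchoutenLocal.
Variable S : mform A -> mform A -> mform A.
Hypothesis hS : is_schouten S.

Lemma schoutenDr k1 k2 (P Q Q' : mform A) : multisection k1 P ->
  multisection k2 Q -> multisection k2 Q' ->
  S P (fun p s => Q p s + Q' p s) = (fun p s => S P Q s + S P Q' s).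
Proof.
move=> kP kQ kQ'; rewrite (schouten_anti hS kP (multisectionD kQ kQ')).
have e : (fun p s => Q p s + Q' p s) = (fun p s => 1 * Q p s + Q' p s).
  by apply: functional_extensionality_dep => p; apply/funext => s; rewrite mul1r.
rewrite e (schouten_linear hS 1 kQ kQ' kP).
rewrite (schouten_anti hS kP kQ) (schouten_anti hS kP kQ').
by apply: functional_extensionality_dep => p; apply/funext => s; ring.
Qed.

Lemma schoutenPr k1 k2 r (P Q Q' : mform A) : multisection k1 P ->
  multisection k2 Q -> multisection k2 Q' ->
  S P (fun p s => r * Q p s + Q' p s) = (fun p s => r * S P Q s + S P Q' s).
Proof.
move=> kP kQ kQ'; rewrite (schouten_anti hS kP (kformP r kQ kQ')).
rewrite (schouten_linear hS r kQ kQ' kP).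
rewrite (schouten_anti hS kP kQ) (schouten_anti hS kP kQ').
by apply: functional_extensionality_dep => p; apply/funext => s; ring.
Qed.

Lemma schouten2C P Q : multisection 2 P -> multisection 2 Q -> S P Q = S Q P.
Proof.
move=> kP kQ; rewrite (schouten_anti hS kP kQ).
apply: functional_extensionality_dep => p; apply/funext => s.
by rewrite -signr_odd /= expr1 mulN1r opprK.
Qed.

Lemma schoutenDl P P' Q : multisection 2 P -> multisection 2 P' ->
  multisection 2 Q ->
  S (fun p s => P p s + P' p s) Q = (fun p s => S P Q s + S P' Q s).
Proof.
move=> kP kP' kQ; rewrite schouten2C//; last exact: multisectionD.
by rewrite (schoutenDr kQ kP kP') (schouten2C kQ kP) (schouten2C kQ kP').
Qed.

Lemma schouten0l Q : multisection 2 Q -> S (fun _ _ => 0) Q = (fun _ _ => 0).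
Proof.
move=> kQ; have k0 := @kform_zero _ _ (dual A) 2.
have := schoutenDl k0 k0 kQ.
have -> : (fun (q : M) (s : seq (dual A q)) => 0 + 0 : R) = (fun _ _ => 0).
  by apply: functional_extensionality_dep => q; apply/funext => s; rewrite addr0.
move=> e; apply: functional_extensionality_dep => p; apply/funext => s.
have := congr1 (fun D : mform A => D p s) e => /eqP.
by rewrite -subr_eq subrr eq_sym => /eqP.
Qed.

Lemma schouten_sum_left I (r : seq I) (X Y : I -> section A) Q a b c p :
  (forall i, smooth_section (X i)) -> (forall i, smooth_section (Y i)) ->
  multisection 2 Q ->
  smooth_section a -> smooth_section b -> smooth_section c ->
  (forall i, S (wedge2 (X i) (Y i)) Q [:: a p; b p; c p] =
     jacobiator (wedge2 (X i) (Y i)) Q a b c p) ->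
  S (wedge2_sum r X Y) Q [:: a p; b p; c p] = jacobiator (wedge2_sum r X Y) Q a b c p.
Proof.
move=> sX sY kQ sa sb sc H; elim: r => [|i r IH].
  by rewrite wedge2_sum_nil schouten0l// jacobiator0l.
have k1 := multisection_wedge2 (sX i) (sY i).
have k2 := multisection_wedge2_sum r sX sY.
by rewrite wedge2_sum_cons schoutenDl// jacobiatorDl// H IH.
Qed.

Lemma schouten_wedge2_sumE I (r : seq I) (X Y : I -> section A) a b c p :
  (forall i, smooth_section (X i)) -> (forall i, smooth_section (Y i)) ->
  smooth_section a -> smooth_section b -> smooth_section c ->
  S (wedge2_sum r X Y) (wedge2_sum r X Y) [:: a p; b p; c p] =
  jacobiator (wedge2_sum r X Y) (wedge2_sum r X Y) a b c p.
Proof.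
move=> sX sY sa sb sc; have k := multisection_wedge2_sum r sX sY.
apply: schouten_sum_left => // i; have ki := multisection_wedge2 (sX i) (sY i).
rewrite schouten2C// jacobiatorC; apply: schouten_sum_left => // j.
exact: schouten_wedge2E.
Qed.

(** For a 2-section P and a covector [xi] at [p], the map sending f to the value
of [P, f] on [xi] is a tangent vector; so it vanishes on flat cutoffs. *)
Lemma schouten_form0_tangent P p (xi : dual A p) : multisection 2 P ->
  tangent_vector p (fun f => S P (form0 (dual A) f) [:: xi]).
Proof.
move=> kP; split=> [r f g sf sg|f g sf sg].
  have -> : form0 (dual A) (fun q => r * f q + g q) =
      (fun q s => r * form0 (dual A) f q s + form0 (dual A) g q s).
    apply: functional_extensionality_dep => q; apply/funext => -[|? ?] //=.
    by rewrite mulr0 addr0.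
  by rewrite (schoutenPr r kP (kform_form0 _ sf) (kform_form0 _ sg)).
have -> : form0 (dual A) (fun q => f q * g q) =
    wedge (form0 (dual A) f) (form0 (dual A) g).
  apply: functional_extensionality_dep => q; apply/funext => s.
  by rewrite wedge_form0; case: s => [|? ?] //=; rewrite mulr0.
rewrite (schouten_wedge hS kP (kform_form0 _ sf) (kform_form0 _ sg)).
rewrite muln0 expr0 mul1r wedge_form0; congr (_ + _).
by rewrite /wedge /= !big_cons big_nil /= addr0 mulr0 addr0 mul1r.
Qed.

(** Multiplying by a function which is 1 and has no derivative at [p] does not
change the Schouten bracket at [p]. *)
Lemma schouten_scale P Q u p s : multisection 2 P -> multisection 2 Q ->
  smooth_fun u -> u p = 1 -> (forall D, tangent_vector p D -> D u = 0) ->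
  S P (fun q s => u q * Q q s) (p := p) s = S P Q s.
Proof.
move=> kP kQ su u1 Du.
have -> : (fun q s => u q * Q q s) = wedge (form0 (dual A) u) Q.
  by apply: functional_extensionality_dep => q; apply/funext => s'; rewrite wedge_form0.
rewrite (schouten_wedge hS kP (kform_form0 _ su) kQ).
rewrite muln0 expr0 mul1r wedge_form0 u1 mul1r wedge_eq0l ?add0r// => s'.
have := schouten_degree hS kP (kform_form0 _ su) => /= -[h _ _ _].
have [s1|s1] := eqVneq (size s') 1; last exact: h.
case: s' s1 => [|xi []]// _.
exact: (Du _ (schouten_form0_tangent xi kP)).
Qed.

End SchoutenLocal.

Lemma jacobiator_scale P u a b c p : multisection 2 P ->
  smooth_section a -> smooth_section b -> smooth_section c ->
  smooth_fun u -> u p = 1 -> (forall D, tangent_vector p D -> D u = 0) ->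
  jacobiator (fun q s => u q * P q s) (fun q s => u q * P q s) a b c p =
  jacobiator P P a b c p.
Proof.
move=> kP sa sb sc su u1 Du.
suff H x y z : smooth_section x -> smooth_section y -> smooth_section z ->
    jacobiator_term (fun q s => u q * P q s) (fun q s => u q * P q s) x y z p =
    jacobiator_term P P x y z p.
  by rewrite /jacobiator !H.
move=> sx sy sz; rewrite /jacobiator_term.
have ru (X : section A) : rho X u p = 0 by apply: Du; exact: anchor_tangent.
have E (w : section (dual A)) : (fun q => sharp (fun q s => u q * P q s) (w q)) =
    (fun q => u q *: sharp P (w q)).
  apply: functional_extensionality_dep => q; apply: sharp_unique; first exact: kformM.
  by move=> eta; rewrite linearZ /= sharpE.
have sS (w : section (dual A)) : smooth_section w ->
    smooth_section (fun q => sharp P (w q)).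
  by move=> sw; exact: (sharp_smooth kP sw).
have sP (v w : section (dual A)) : smooth_section v -> smooth_section w ->
    smooth_fun (fun q => P q [:: v q; w q]).
  by move=> sv sw; exact: (smooth_kform2 kP openT sv sw).
have sU (X : section A) : smooth_section X -> smooth_section (fun q => u q *: X q).
  exact: smooth_sectionZ.
have lb (X Y : section A) : smooth_section X -> smooth_section Y ->
    lbr (fun q => u q *: X q) (fun q => u q *: Y q) p = lbr X Y p.
  move=> sX sY; rewrite lbr_leibniz//; last exact: sU.
  rewrite lbr_anti//; last exact: sU.
  rewrite lbr_leibniz// -/(rho (fun q => u q *: X q) u p) -/(rho Y u p) !ru u1.
  rewrite !scale0r !scale1r !addr0.
  by rewrite -lbr_anti.
have rh (X : section A) (g : M -> R) : smooth_fun g ->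
    rho (fun q => u q *: X q) (fun q => u q * g q) p = rho X g p.
  move=> sg; rewrite rhoM// ru mul0r add0r u1 mul1r /rho u1 scale1r.
  by [].
by rewrite !E !lb ?rh//; try exact: sS; exact: sP.
Qed.

(** If no bracket satisfies the axioms, then [schouten] is 0 by its default
value; so the existence of the Schouten bracket is not needed here. *)
Lemma schouten_eq0 P : multisection 2 P ->
  (forall a b c p, smooth_section a -> smooth_section b -> smooth_section c ->
     jacobiator P P a b c p = 0) ->
  schouten P P = (fun _ _ => 0).
Proof.
move=> kP H; rewrite /schouten; case: xgetP => [S _ hS|//].
apply: functional_extensionality_dep => p; apply/funext => s.
have [h _ _ _] := schouten_degree hS kP kP.
have [s3|s3] := eqVneq (size s) 3; last exact: h.
case: s s3 => [|al [|be [|ga []]]]// _.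
have [a [sa <-]] := smooth_extension al.
have [b [sb <-]] := smooth_extension be.
have [c [sc <-]] := smooth_extension ga.
have [u [su u1 Du [I [r [X [Y [sX sY eP]]]]]]] := decompose_multisection p kP.
have kuP : multisection 2 (fun q s => u q * P q s) by exact: kformM.
rewrite -(schouten_scale hS _ kP kP su u1 Du) (schouten2C hS kP kuP).
rewrite -(schouten_scale hS _ kuP kP su u1 Du) eP schouten_wedge2_sumE// -eP.
by rewrite jacobiator_scale// H.
Qed.

End Decompose.

(** * The Dirac condition makes the Schouten square vanish *)

Section Conclusion.
Context {R : realType} {M : manifold R}.

(** Pairing the Dirac condition for [a] and [b] with [c] gives half of the
[jacobiator]; the twist by phi drops out, as phi vanishes on the image of
pi#. *)
Lemma dirac_jacobiator (J : jacobi_algebroid M) (pi : mform J) a b c p :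
  multisection 2 pi -> (forall q (xi : dual J q), @jphi R M J q (sharp pi xi) = 0) ->
  Defs.dirac (graph_sharp pi) ->
  smooth_section a -> smooth_section b -> smooth_section c ->
  jacobiator pi pi a b c p = 0.
Proof.
move=> kpi phi0 /(dirac_graphP kpi) H sa sb sc.
have [sk Hk] := H _ _ sa sb.
have sZ := sharp_smooth kpi sc.
have kE := @koszulE R M J pi kpi a b _ p sa sb sZ.
have : c p (lbr (fun q => sharp pi (a q)) (fun q => sharp pi (b q)) p) =
    - koszul pi a b p (sharp pi (c p)).
  by rewrite Hk !sharpE// (kform2_anti kpi).
have eb : (fun q => b q (sharp pi (c q))) = (fun q => 0 - pi q [:: b q; c q]).
  by apply/funext => q; rewrite sharpE// (kform2_anti kpi) sub0r.
have ea : (fun q => a q (sharp pi (c q))) = (fun q => pi q [:: c q; a q]).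
  by apply/funext => q; rewrite sharpE.
have sbc : smooth_fun (fun q => pi q [:: b q; c q]).
  exact: (smooth_kform2 kpi openT sb sc).
rewrite kE !phi0 eb ea rhoB// ?rho_cst; last exact: smooth_fun_cst.
rewrite (lbr_anti (sharp_smooth kpi sa) sZ) linearN /= /jacobiator /jacobiator_term.
lra.
Qed.

Lemma dirac_schouten (J : jacobi_algebroid M) (pi : mform J) :
  multisection 2 pi -> (forall q (xi : dual J q), @jphi R M J q (sharp pi xi) = 0) ->
  Defs.dirac (graph_sharp pi) -> schouten pi pi = (fun _ _ => 0).
Proof.
move=> kpi phi0 D; apply: schouten_eq0 => // a b c p sa sb sc.
exact: dirac_jacobiator.
Qed.

Lemma poisson_of_dirac (A : lie_algebroid M) (pi : mform A) :
  multisection 2 pi -> Defs.dirac (J := zero_jacobi A) (graph_sharp pi) ->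
  poisson_structure pi.
Proof.
move=> kpi D; split => //.
apply: (dirac_schouten (J := zero_jacobi A)) => // q xi.
by rewrite /= /zero_section lfunE.
Qed.

Lemma jacobi_of_dirac (A : lie_algebroid M) (pi : mform A) :
  multisection 2 pi ->
  Defs.dirac (J := plusR_jacobi A) (graph_sharp (plusR_pair pi (zero_section A))) ->
  jacobi_structure (J := plusR_jacobi A) (plusR_pair pi (zero_section A)).
Proof.
move=> kpi D; have kpih := plusR_pair_multisection kpi; split=> //.
have phi0 q (xi : dual (plusR A) q) :
    @jphi R M (plusR_jacobi A) q (sharp (plusR_pair pi (zero_section A)) xi) = 0.
  by rewrite sharp_plusR//; exact: phi01E.
have io : iota_form (@jphi R M (plusR_jacobi A)) (plusR_pair pi (zero_section A)) =
    (fun _ _ => 0).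
  apply: functional_extensionality_dep => p; apply/funext => s.
  case: s => [|xi [|? ?]]//; rewrite /iota_form plusR_pairE.
  by rewrite [dual_fst _]dual_fst_pair (kform2_0l kpi).
apply: functional_extensionality_dep => p; apply/funext => s.
rewrite /jschouten (dirac_schouten (J := plusR_jacobi A) kpih phi0 D) io.
have -> : wedge (plusR_pair pi (zero_section A)) (fun _ _ => 0) p s = 0.
  by rewrite /wedge big1// => c _; rewrite mulr0.
by rewrite wedge_eq0l// !mulr0 subr0 addr0.
Qed.

End Conclusion.

Theorem theorem4p2 (R : realType) (M : manifold R) (A : lie_algebroid M)
    (pi1 pi2 : mform A)
    (hpi1 : multisection 2 pi1) (hpi2 : multisection 2 pi2) :
  poisson_pair pi1 pi2 <->
  jacobi_pair (J := plusR_jacobi A)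
    (plusR_pair pi1 (zero_section A)) (plusR_pair pi2 (zero_section A)).
Proof.
split=> [[_ _ [D1 D2 N]]|[_ _ [D1 D2 N]]].
  have D1' := (dirac_plusR hpi1).2 D1; have D2' := (dirac_plusR hpi2).2 D2.
  split; [exact: jacobi_of_dirac|exact: jacobi_of_dirac|split => //].
  exact/(nijenhuis_plusR hpi1 hpi2).
have D1' := (dirac_plusR hpi1).1 D1; have D2' := (dirac_plusR hpi2).1 D2.
split; [exact: poisson_of_dirac|exact: poisson_of_dirac|split => //].
exact/(nijenhuis_plusR hpi1 hpi2).
Qed.
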